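(* Let $n\ge 1$, let $\Omega_1,\dots,\Omega_n$ be Polish spaces, $\mathbf\Omega=\prod_{i=1}^n\Omega_i$, and let $\mathbf c=(c_1,\dots,c_n)\in\mathbb R_+^n$. Let $f:\mathbf\Omega\to\mathbb R$ be $\mathbf c$-Lipschitz, and let $\mathbf X=(X_1,\dots,X_n)$ be an $\mathbf\Omega$-valued random vector that is $G$-dependent, where $G$ is a graph with vertex set $\{1,\dots,n\}$. Then for any $t>0$, $$\mathbb P\big(f(\mathbf X)-\mathbb E f(\mathbf X)\ge t\big)\le \exp\left(-\frac{2t^2}{D(G,\mathbf c)}\right),$$ where $$D(G,\mathbf c):=\min_{(F,\{F_x\}_{x\in V(F)})\in \mathsf{TP}(G)}\left(\sum_{T\in\mathcal T(F)}\widetilde c_{\min,T}^{\,2}+\sum_{\{u,v\}\in E(F)}(\widetilde c_u+\widetilde c_v)^2\right),$$ with $\widetilde c_u:=\sum_{i\in F_u}c_i$ for all $u\in V(F)$ and $\widetilde c_{\min,T}:=\min\{\widetilde c_i: i\in V(T)\}$ for all $T\in\mathcal T(F)$.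
   Context: All graphs are finite, undirected and simple; $V(G)$, $E(G)$ denote the vertex and edge sets. $\mathbb R_+$ is the set of non-negative reals. $f:\mathbf\Omega\to\mathbb R$ is $\mathbf c$-Lipschitz if $|f(\mathbf x)-f(\mathbf x')|\le\sum_{i=1}^n c_i\mathbf 1_{\{x_i\ne x_i'\}}$ for all $\mathbf x,\mathbf x'\in\mathbf\Omega$. Functions are assumed measurable so that the expectations make sense. $\mathbf X=(X_1,\dots,X_n)$ is $G$-dependent (that is, $G$ is a dependency graph of $\mathbf X$) if $V(G)=\{1,\dots,n\}$ and, for all disjoint $I,J\subset\{1,\dots,n\}$ such that no edge of $G$ has one endpoint in $I$ and the other in $J$, the families $\{X_i\}_{i\in I}$ and $\{X_j\}_{j\in J}$ are independent. A forest is a disjoint union of trees; for a forest $F$, $\mathcal T(F)$ is the set of its disjoint trees (connected components). A tree-partition of $G$ is a pair $(F,\{F_x\}_{x\in V(F)})$, where $F$ is a forest and the $F_x\subseteq V(G)$ (''bags'') are such that (i) every vertex of $G$ lies in exactly one bag; (ii) distinct $u,v\in V(F)$ are adjacent in $F$ if and only if some edge of $G$ has one endpoint in $F_u$ and the other in $F_v$. $\mathsf{TP}(G)$ is the set of all tree-partitions of $G$. *)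

(* Defs.v *)
From HB Require Import structures.
From mathcomp Require Import all_boot all_order all_algebra.
From mathcomp Require Import all_classical all_reals all_analysis.

Set Implicit Arguments.
Unset Strict Implicit.
Unset Printing Implicit Defensive.

Import Order.TTheory GRing.Theory Num.Theory.
Import numFieldNormedType.Exports.

Local Open Scope classical_set_scope.
Local Open Scope ring_scope.

Record sgraph (V : finType) := SGraph {
  adj :> rel V;
  adj_sym : symmetric adj;
  adj_irr : irreflexive adj
}.

Section Graphs.
Variables (V : finType) (F : sgraph V).

Definition edges : {set {set V}} :=
  [set [set p.1; p.2] | p in [set p : V * V | F p.1 p.2]]%SET.

(* [ucycle] is a cycle without repeated vertices; in a simple graph those with
   at most two vertices are the empty ones and the traversals of one edge. *)
Definition forest : Prop :=
  forall s : seq V, (2 < size s)%N -> ~ ucycle F s.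

(* The connected components, as vertex sets. *)
Definition trees : {set {set V}} :=
  [set [set v | connect F u v] | u : V]%SET.

End Graphs.

(* Bags may be empty. *)
Record tree_partition (W : finType) (G : sgraph W) := TreePartition {
  tp_vertex : finType;
  tp_forest : sgraph tp_vertex;
  tp_bag : tp_vertex -> {set W};
  tp_forestP : forest tp_forest;
  tp_cover : forall i : W, exists! x, i \in tp_bag x;
  tp_adj : forall u v, u != v ->
    (tp_forest u v <->
     exists i j, [/\ i \in tp_bag u, j \in tp_bag v & G i j])
}.

Section Weights.
Variables (R : realType) (W : finType) (G : sgraph W) (c : W -> R).

Definition ctilde {p : tree_partition G} (u : tp_vertex p) : R :=
  \sum_(i in tp_bag u) c i.

(* A minimum over the nonempty finite set T, see [ctilde_min_attained]. *)
Definition ctilde_min {p : tree_partition G} (T : {set tp_vertex p}) : R :=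
  inf [set ctilde u | u in [set` T]].

(* The inner sum of the second term is over the two ends of the edge. *)
Definition tp_weight (p : tree_partition G) : R :=
  \sum_(T in trees (tp_forest p)) ctilde_min T ^+ 2 +
  \sum_(e in edges (tp_forest p)) (\sum_(u in e) ctilde u) ^+ 2.

(* This infimum is a minimum, see [Dweight_attained]. It can be 0 (when c = 0);
   the division by it should be done in \bar R, where x / 0 = +oo for x > 0. *)
Definition Dweight : R := inf [set w | exists p, w = tp_weight p].

End Weights.
Arguments tp_weight {R W G} c p.
Arguments ctilde {R W G} c {p} u.
Arguments ctilde_min {R W G} c {p} T.

Lemma inf_attained (R : realType) (A : set R) (m : R) :
  A m -> lbound A m -> inf A = m.
Proof.
move=> Am lbm; apply/eqP; rewrite eq_le; apply/andP; split.
  by apply: ge_inf => //; exists m.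
by apply: lb_le_inf => //; exists m.
Qed.

Lemma edge_sumE (R : realType) (W : finType) (G : sgraph W) (c : W -> R)
    (p : tree_partition G) (u v : tp_vertex p) : tp_forest p u v ->
  \sum_(x in [set u; v]%SET) ctilde c x = ctilde c u + ctilde c v.
Proof.
move=> uv; rewrite big_setU1 ?big_set1//= inE.
by apply/eqP => uvE; rewrite uvE adj_irr in uv.
Qed.

Lemma ctilde_min_attained (R : realType) (W : finType) (G : sgraph W)
    (c : W -> R) (p : tree_partition G) (T : {set tp_vertex p}) :
  T \in trees (tp_forest p) ->
  exists2 u, u \in T &
    ctilde_min c T = ctilde c u /\ forall v, v \in T -> ctilde c u <= ctilde c v.
Proof.
case/imsetP => u0 _ TE.
have u0T : u0 \in T by rewrite TE inE connect0.
case: (arg_minP (ctilde c) u0T) => u uT umin.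
exists u => //; split; last by move=> v vT; exact: umin.
apply: inf_attained; first by exists u.
by move=> _ [v vT <-]; exact: umin.
Qed.

(* Nonnegative integer combinations of finitely many nonnegative reals are
   well ordered. *)
Lemma combination_min (R : realType) (J : finType) (w : J -> R) (A : set R) :
  (forall j, 0 <= w j) ->
  (forall a, A a -> exists k : J -> nat, a = \sum_j w j *+ k j) ->
  A !=set0 -> exists2 m, A m & lbound A m.
Proof.
move=> w0 Ak [a0 Aa0].
have a0_ge0 : 0 <= a0.
  by have [k ->] := Ak _ Aa0; apply: sumr_ge0 => j _; rewrite mulrn_wge0.
pose N := \max_j Num.truncn (a0 / w j).
pose val (k : {ffun J -> 'I_N.+1}) := \sum_j w j *+ k j.
have bounded a : A a -> a <= a0 -> exists k, a = val k.
  move=> Aa aa0; have [k aE] := Ak _ Aa.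
  exists [ffun j => inord (if w j == 0 then 0%N else k j)].
  rewrite {1}aE; apply: eq_bigr => j _; rewrite ffunE inordK ?ltnS.
    by case: eqP => // ->; rewrite !mul0rn.
  case: eqP => // /eqP wj0.
  have wjp : 0 < w j by rewrite lt_neqAle eq_sym wj0 w0.
  apply: leq_trans (leq_bigmax j).
  rewrite -ltnS -(ltr_nat R); apply: le_lt_trans (truncnS_gt _).
  rewrite ler_pdivlMr// mulr_natl (le_trans _ aa0)// aE (bigD1 j)//= lerDl.
  by apply: sumr_ge0 => i _; rewrite mulrn_wge0.
have [k0 a0E] := bounded _ Aa0 (lexx _).
have k0A : `[< A (val k0) >] by apply/asboolP; rewrite -a0E.
case: (@arg_minP _ _ _ k0 (fun k => `[< A (val k) >]) val k0A) => k /asboolP kA kmin.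
exists (val k) => // a Aa.
have [aa0|/ltW] := leP a a0.
  by have [k' aE] := bounded _ Aa aa0; rewrite aE; apply: kmin; apply/asboolP; rewrite -aE.
by apply: le_trans; rewrite a0E; apply: kmin.
Qed.

Lemma trivial_tree_partition (W : finType) (G : sgraph W) : tree_partition G.
Proof.
have sF : symmetric (fun _ _ : unit => false) by [].
have iF : irreflexive (fun _ _ : unit => false) by [].
apply: (@TreePartition W G unit (SGraph sF iF) (fun=> [set: W]%SET)).
- by case=> [|x [|y s]]// _ /andP[].
- by move=> i; exists tt; split; rewrite ?inE// => -[].
- by move=> [] [].
Qed.

Lemma Dweight_attained (R : realType) (W : finType) (G : sgraph W)
    (c : W -> R) :
  exists2 p : tree_partition G, Dweight G c = tp_weight c p &
    forall q : tree_partition G, Dweight G c <= tp_weight c q.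
Proof.
pose D : set R := [set w | exists p : tree_partition G, w = tp_weight c p].
suff [m [p pm] mlb] : exists2 m, D m & lbound D m.
  have DE : Dweight G c = m by apply: inf_attained => //; exists p.
  by exists p; rewrite [Dweight G c]DE// => q; apply: mlb; exists q.
apply: (@combination_min R {set W} (fun A => (\sum_(i in A) c i) ^+ 2)).
- by move=> A; exact: sqr_ge0.
- move=> _ [p ->].
  pose C (A : {set W}) := \sum_(i in A) c i.
  have group (I : finType) (S : {set I}) (x : I -> R) :
      (forall i, i \in S -> exists A, x i = C A) ->
      exists k : {set W} -> nat, \sum_(i in S) x i ^+ 2 = \sum_A C A ^+ 2 *+ k A.
    move=> /(_ _ _)/cid hx.
    pose h i := if pselect (i \in S) is left iS then sval (hx i iS) else finset.set0.
    exists (fun A => #|[set i in S | h i == A]%SET|).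
    rewrite (partition_big h xpredT)//=; apply: eq_bigr => A _.
    rewrite -sumr_const; apply: eq_big => [i|i /andP[iS /eqP hiA]].
      by rewrite inE.
    by rewrite -hiA /h; case: pselect => // iS'; case: (hx i iS') => /= B ->.
  have /group[k1 E1] : forall T : {set tp_vertex p}, T \in trees (tp_forest p) ->
      exists A, ctilde_min c T = C A.
    by move=> T /(ctilde_min_attained c)[u _ [-> _]]; exists (tp_bag u).
  have /group[k2 E2] : forall e : {set tp_vertex p}, e \in edges (tp_forest p) ->
      exists A, \sum_(u in e) ctilde c u = C A.
    move=> e /imsetP[[u v]]; rewrite inE/= => uv ->; rewrite edge_sumE//.
    exists (tp_bag u :|: tp_bag v)%SET; rewrite /C.
    rewrite (eq_bigl [predU tp_bag u & tp_bag v])/=; last by move=> i; rewrite !inE.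
    rewrite bigU//=.
    rewrite -finset.setI_eq0; apply/eqP/setP => i; rewrite !inE; apply/negP => /andP[iu iv].
    have [x [_ xu]] := tp_cover p i.
    by move: uv; rewrite -(xu _ iu) -(xu _ iv) adj_irr.
  exists (fun A => (k1 A + k2 A)%N); rewrite /tp_weight E1 E2 -big_split/=.
  by apply: eq_bigr => A _; rewrite mulrnDr.
- by exists (tp_weight c (trivial_tree_partition G)), (trivial_tree_partition G).
Qed.

(* Separable and completely metrizable; the metric is not part of the data. *)
Definition polish (R : realType) (T : topologicalType) : Prop :=
  (exists2 S : set T, countable S & dense S) /\
  exists d : T -> T -> R,
    [/\ forall x y, d x y = 0 <-> x = y,
        forall x y, d x y = d y x,
        forall x y z, d x z <= d x y + d y z,
        forall (x : T) (A : set T),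
          nbhs x A <-> exists2 e, 0 < e & [set y | d x y < e] `<=` A
      & forall u : nat -> T,
          (forall e, 0 < e -> exists N, forall m n : nat,
            (N <= m)%N -> (N <= n)%N -> d (u m) (u n) < e) ->
          exists l : T, u @ \oo --> l].

Definition borel (T : ptopologicalType) := g_sigma_algebraType (@open T).

(* The product sigma-algebra of the Borel sigma-algebras; for Polish spaces it
   is the Borel sigma-algebra of the product topology. *)
Definition cylinders (n : nat) (T : 'I_n -> ptopologicalType) :
    set (set (forall i, T i)) :=
  [set A | exists i, exists2 B : set (borel (T i)),
     measurable B & A = (fun x : forall i, T i => x i) @^-1` B].

Definition prod_borel (n : nat) (T : 'I_n -> ptopologicalType) :=
  g_sigma_algebraType (@cylinders n T).

Definition lipschitz_wrt (R : realType) (n : nat) (T : 'I_n -> ptopologicalType)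
    (c : 'I_n -> R) (f : (forall i, T i) -> R) : Prop :=
  forall x y : forall i, T i,
    `|f x - f y| <= \sum_(i < n) c i * (x i != y i)%:R.

Section Dependence.
Context (d : measure_display) (S : measurableType d) (R : realType).
Variables (P : probability S R) (n : nat) (T : 'I_n -> ptopologicalType).

Definition sigma_family (X : S -> forall i, T i) (I : {set 'I_n}) :
    set (set S) :=
  <<s \bigcup_(i in [set` I])
        preimage_set_system setT (fun w => X w i : borel (T i)) measurable >>.

Definition graph_dependent (X : S -> forall i, T i) (G : sgraph 'I_n) : Prop :=
  forall I J : {set 'I_n}, [disjoint I & J]%B ->
    (forall i j, i \in I -> j \in J -> ~~ G i j) ->
    forall A B : set S, sigma_family X I A -> sigma_family X J B ->
      P (A `&` B) = (P A * P B)%E.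

End Dependence.

(* Main.v *)
Require Import Defs.
From HB Require Import structures.
From mathcomp Require Import all_boot all_order all_algebra.
From mathcomp Require Import all_classical all_reals all_analysis.
From mathcomp Require Import ring lra.

Set Implicit Arguments.
Unset Strict Implicit.
Unset Printing Implicit Defensive.

Import Order.TTheory GRing.Theory Num.Theory.
Import numFieldNormedType.Exports.

Local Open Scope classical_set_scope.
Local Open Scope ring_scope.


(** Replacing the variables by the bags of a tree-partition, one may assume that
    the dependency graph is a forest.  Reveal the bags along the forest, each
    tree ending with its lightest vertex as root, every other bag before its
    parent.  When a bag [i] with parent [q] is revealed, the component of [i]
    among the bags revealed so far is independent of everything else but [q].
    Bounding [f] between its minimum and maximum over the bags [i] and [q]
    thus confines the martingale difference to an interval of length at most
    [c_i + c_q] (or [c_i] for a root); Hoeffding's lemma and Chernoff's bound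
    conclude.

    This argument is carried out for finitely valued variables, where no
    conditional law has to be constructed.  The general case reduces to it: Polishness
    gives, by regularity of Borel measures, a nearly full set on which [f] is
    continuous and which is totally bounded; a compactness argument shows that
    there, points with nearby coordinates may be treated as having equal ones in
    the Lipschitz inequality, so that [f] is uniformly close to a Lipschitz
    function of finitely many Borel cells. *)

(** * Hoeffding's lemma *)

Section HoeffdingLemma.
Variable R : realType.

(** The logistic function [u] solves u' = u (1 - u), which is at most 1/4; the mean value theorem
    then bounds its growth from [u 0 = th]. *)
Lemma logistic_bound (th h : R) : 0 <= th <= 1 -> 0 <= h ->
  th * expR h / (1 - th + th * expR h) <= th + h / 4.
Proof.
move=> /andP[th0 th1] h0.
have den_gt0 x : 0 < 1 - th + th * expR x.
  by have := expR_gt0 x; nra.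
pose u x := th * expR x / (1 - th + th * expR x).
have du (x : R) : is_derive x 1 u (u x * (1 - u x)).
  have den_neq0 : 1 - th + th * expR x != 0 by rewrite gt_eqF.
  have d1 : is_derive x 1 (fun x => th * expR x) (th * expR x).
    exact: is_deriveZ.
  have d2 : is_derive x 1 (fun x => 1 - th + th * expR x) (th * expR x).
    have := is_deriveD (is_derive_cst (1 - th) x 1) d1.
    by rewrite add0r.
  have d3 := @is_deriveV _ (fun x => 1 - th + th * expR x) _ _ _ den_neq0 d2.
  apply: is_derive_eq (is_deriveM d1 d3) _.
  rewrite /u /GRing.scale/=; field.
  exact: den_neq0.
have cu : {within `[0, h], continuous u}.
  apply: continuous_subspaceT => x; apply: differentiable_continuous.
  by apply/derivable1_diffP; case: (du x).
have [x _ uE] := MVT_segment h0 (fun x _ => du x) cu.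
have u0 : u 0 = th by rewrite /u expR0 mulr1 subrK divr1.
have -> : th * expR h / (1 - th + th * expR h) = u h by [].
have : u x * (1 - u x) <= 1 / 4.
  rewrite -subr_ge0; have -> : 1 / 4 - u x * (1 - u x) = (u x - 1 / 2) ^+ 2.
    by field.
  exact: sqr_ge0.
move: uE; rewrite u0 subr0 => uE b.
have := ler_wpM2r h0 b; lra.
Qed.

(** The logarithm of the moment generating function of a Bernoulli variable has the logistic
    function as derivative. Hence [phi], the difference of the two exponents, vanishes at 0 and has
    a nonnegative derivative by [logistic_bound]. *)
Lemma bernoulli_mgf_bound (th h : R) : 0 <= th <= 1 -> 0 <= h ->
  1 - th + th * expR h <= expR (th * h + h ^+ 2 / 8).
Proof.
move=> th01 h0; have /andP[th0 th1] := th01.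
have den_gt0 x : 0 < 1 - th + th * expR x.
  by have := expR_gt0 x; nra.
pose phi x := th * x + 8^-1 * x ^+ 2 - ln (1 - th + th * expR x).
pose dphi x := th + x / 4 - th * expR x / (1 - th + th * expR x).
have dp (x : R) : is_derive x 1 phi (dphi x).
  have d2 : is_derive x 1 (fun x => 1 - th + th * expR x) (th * expR x).
    have d1 : is_derive x 1 (fun x => th * expR x) (th * expR x).
      exact: is_deriveZ.
    have := is_deriveD (is_derive_cst (1 - th) x 1) d1.
    by rewrite add0r.
  have d3 := @is_derive1_comp _ (@ln R) (fun x => 1 - th + th * expR x) _ _ _
    (is_derive1_ln (den_gt0 x)) d2.
  have d4 : is_derive x 1 (fun x => th * x + 8^-1 * x ^+ 2) (th + x / 4).
    have d5 := is_deriveZ (8^-1) (is_deriveX 2 (is_derive_id x 1)).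
    apply: is_derive_eq (is_deriveD (is_deriveZ th (is_derive_id x 1)) d5) _.
    by rewrite /GRing.scale/= !mulr1 expr1; field.
  apply: is_derive_eq (is_deriveB d4 d3) _.
  by rewrite /dphi [_^-1 * (_ * _)]mulrC.
have cp : {within `[0, h], continuous phi}.
  apply: continuous_subspaceT => x; apply: differentiable_continuous.
  by apply/derivable1_diffP; case: (dp x).
have [x + phiE] := MVT_segment h0 (fun x _ => dp x) cp.
rewrite in_itv/= => /andP[x0 xh].
have phi0 : phi 0 = 0.
  by rewrite /phi expR0 mulr1 subrK ln1 expr0n/= !mulr0 addr0 subr0.
have : 0 <= phi h.
  move: phiE; rewrite phi0 !subr0 => ->; apply: mulr_ge0 => //.
  by have := logistic_bound th01 x0; rewrite /dphi; lra.
by rewrite /phi subr_ge0 -ler_expR lnK ?posrE// [8^-1 * _]mulrC.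
Qed.

(* The chord bound is the convex combination of the two tangent lines at [a]. *)
Lemma expR_chord (a m h : R) : 0 < h -> m <= a <= m + h ->
  expR a <= expR m * (1 - (a - m) / h + (a - m) / h * expR h).
Proof.
move=> h0 /andP[ma amh].
have -> : expR m * (1 - (a - m) / h + (a - m) / h * expR h) =
  (1 - (a - m) / h) * expR m + (a - m) / h * expR (m + h).
  by rewrite expRD; ring.
have tangent x : expR a * (1 + (x - a)) <= expR x.
  rewrite -[in leRHS](subrKC a x) expRD ler_wpM2l ?expR_ge0//.
  exact: expR_ge1Dx.
have t0 : 0 <= (a - m) / h by rewrite divr_ge0 ?subr_ge0// ltW.
have t1 : 0 <= 1 - (a - m) / h.
  by rewrite subr_ge0 ler_pdivrMr// mul1r; lra.
have := lerD (ler_wpM2l t1 (tangent m)) (ler_wpM2l t0 (tangent (m + h))).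
apply: le_trans; rewrite le_eqVlt; apply/orP; left; apply/eqP.
by field; rewrite gt_eqF.
Qed.

(** Averaging the chord bound replaces [a] by a variable of the same mean on the two ends of the
    interval, that is, a Bernoulli variable of parameter [th]. Points of weight 0 are unconstrained
    and are set aside in each sum. *)
Lemma hoeffding_lemma (I : finType) (q a : I -> R) (m h : R) :
  (forall i, 0 <= q i) -> \sum_i q i = 1 -> 0 <= h ->
  (forall i, q i != 0 -> m <= a i <= m + h) ->
  \sum_i q i * expR (a i) <= expR (\sum_i q i * a i + h ^+ 2 / 8).
Proof.
move=> q0 q1; rewrite le_eqVlt => /predU1P[<-|h0] qa.
  have aE i : q i != 0 -> a i = m.
    by move=> /qa; rewrite addr0 => am; apply/le_anti; rewrite andbC.
  have E (g : R -> R) : \sum_i q i * g (a i) = g m.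
    rewrite -[RHS]mul1r -q1 mulr_suml; apply: eq_bigr => i _.
    by have [->|/aE ->//] := eqVneq (q i) 0; rewrite !mul0r.
  by rewrite E (E id) expr0n/= mul0r addr0.
set mu := \sum_i _ * a i.
pose th := (mu - m) / h.
have muE : mu - m = \sum_i q i * (a i - m).
  rewrite -[in LHS](mul1r m) -q1 mulr_suml -sumrB.
  by apply: eq_bigr => i _; rewrite mulrBr.
have th01 : 0 <= th <= 1.
  rewrite divr_ge0 ?(ltW h0)//= ?ler_pdivrMr ?mul1r// muE.
    rewrite -[leRHS]mul1r -q1 mulr_suml; apply: ler_sum => i _.
    have [->|qi] := eqVneq (q i) 0; first by rewrite !mul0r.
    by apply: ler_wpM2l => //; have /andP[] := qa _ qi; lra.
  apply: sumr_ge0 => i _.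
  have [->|qi] := eqVneq (q i) 0; first by rewrite mul0r.
  by apply: mulr_ge0 => //; have /andP[] := qa _ qi; lra.
apply: (@le_trans _ _ (expR m * (1 - th + th * expR h))).
  have -> : expR m * (1 - th + th * expR h) =
      \sum_i q i * (expR m * (1 - (a i - m) / h + (a i - m) / h * expR h)).
    have -> : 1 - th + th * expR h = 1 + th * (expR h - 1) by ring.
    rewrite /th muE mulr_suml mulr_suml -[X in X + _]q1 -big_split/= mulr_sumr.
    by apply: eq_bigr => i _; ring.
  apply: ler_sum => i _.
  have [->|qi] := eqVneq (q i) 0; first by rewrite !mul0r.
  by rewrite ler_wpM2l// expR_chord// qa.
have -> : mu + h ^+ 2 / 8 = m + (th * h + h ^+ 2 / 8).
  by rewrite /th; field; rewrite gt_eqF.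
by rewrite [in leRHS]expRD ler_wpM2l ?expR_ge0// bernoulli_mgf_bound// ltW.
Qed.

End HoeffdingLemma.

(** * Conditional expectation on a finite space *)

Section FiniteConditioning.
Variables (R : realType) (I : finType) (p : I -> R).
Hypothesis p_ge0 : forall i, 0 <= p i.
Implicit Types (r : rel I) (f g : I -> R).

Definition cmass r f z : R := \sum_(x | r z x) p x * f x.

(* Conditional expectation given the classes of the equivalence relation [r];
   it takes the junk value 0 on classes of mass 0. *)
Definition condE r f z : R := cmass r f z / cmass r (fun=> 1) z.

Lemma cmass1_ge0 r z : 0 <= cmass r (fun=> 1) z.
Proof. by apply: sumr_ge0 => x _; rewrite mulr1. Qed.

Lemma cmass1_gt0 r z : reflexive r -> 0 < p z -> 0 < cmass r (fun=> 1) z.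
Proof.
move=> rr pz; rewrite /cmass (bigD1 z)//= mulr1 ltr_pwDl//.
by apply: sumr_ge0 => x _; rewrite mulr1.
Qed.

Lemma cmass1_eq0 r z x : cmass r (fun=> 1) z = 0 -> r z x -> p x = 0.
Proof.
move=> m0 rzx; move: m0; rewrite /cmass (bigD1 x)//= mulr1 => /eqP.
rewrite paddr_eq0//; last by apply: sumr_ge0 => y _; rewrite mulr1.
by case/andP => /eqP.
Qed.

Lemma condE_scale r a f z : condE r (fun x => a * f x) z = a * condE r f z.
Proof.
rewrite /condE mulrA; congr (_ / _); rewrite mulr_sumr.
by apply: eq_bigr => x _; rewrite mulrCA.
Qed.

Lemma condE_le r f g z : (forall x, f x <= g x) -> condE r f z <= condE r g z.
Proof.
move=> fg; rewrite ler_wpM2r ?invr_ge0 ?cmass1_ge0//.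
by apply: ler_sum => x _; rewrite ler_wpM2l.
Qed.

Lemma condE_add_const r f a z : reflexive r -> 0 < p z ->
  condE r (fun x => f x + a) z = condE r f z + a.
Proof.
move=> rr pz; rewrite /condE.
have -> : cmass r (fun x => f x + a) z = cmass r f z + a * cmass r (fun=> 1) z.
  rewrite /cmass mulr_sumr -big_split/=; apply: eq_bigr => x _; ring.
by rewrite mulrDl mulfK// gt_eqF// cmass1_gt0.
Qed.

Section Tower.
Variables r r' : rel I.
Hypotheses (r_eq : equivalence_rel r) (r_eq' : equivalence_rel r').
Hypothesis rr' : subrel r r'.

Let r_refl : reflexive r. Proof. by case/equivalence_relP: r_eq. Qed.

Let r_sym : symmetric r.
Proof.
suff h x y : r x y -> r y x by move=> x y; apply/idP/idP; exact: h.
by move=> xy; have [rxx /(_ xy) <-] := r_eq x y x.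
Qed.

Let r_congr x y : r x y -> r x =1 r y.
Proof. by move=> h z; have [_ /(_ h)] := r_eq x y z. Qed.

Let r'_congr x y z : r' x y -> r' z x = r' z y.
Proof.
move=> h; have sym' u v : r' u v -> r' v u.
  by move=> k; have [kk /(_ k) <-] := r_eq' u v u.
have [_ /(_ h) e] := r_eq' x y z.
by apply/idP/idP => /sym' k; apply: sym'; rewrite ?e// -e.
Qed.

(** After exchanging the sums, each term [p y * f y] is spread over the class of [y] and collected
    back whole. The junk value does no harm: [p] vanishes on a class of mass 0. *)
Lemma cmass_condE f z : cmass r' (condE r f) z = cmass r' f z.
Proof.
rewrite /cmass /condE.
transitivity (\sum_(x | r' z x) \sum_(y | r' z y && r x y)
    p x * (p y * f y / cmass r (fun=> 1) y)).
  apply: eq_bigr => x zx.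
  rewrite mulr_suml mulr_sumr; apply: eq_big => [y|y xy].
    case xy : (r x y); rewrite ?andbF// andbT.
    by rewrite -(r'_congr z (rr' xy)) zx.
  suff -> : cmass r (fun=> 1) x = cmass r (fun=> 1) y by [].
  by apply: eq_bigl => u; apply: r_congr.
under eq_bigr do rewrite big_mkcondr/=.
rewrite exchange_big/=; apply: eq_bigr => y zy.
transitivity (\sum_(x | r y x) p x * (p y * f y / cmass r (fun=> 1) y)).
  rewrite big_mkcond [RHS]big_mkcond/=; apply: eq_bigr => x _.
  rewrite r_sym; case: ifPn => [zx|]; case: ifPn => // xy.
  by rewrite -(r'_congr z (rr' xy)) zy.
rewrite -mulr_suml.
have -> : \sum_(x | r y x) p x = cmass r (fun=> 1) y.
  by apply: eq_bigr => x _; rewrite mulr1.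
have [m0|m0] := eqVneq (cmass r (fun=> 1) y) 0; last by rewrite mulrC divfK.
by rewrite m0 mul0r (cmass1_eq0 m0 (r_refl y)) mul0r.
Qed.

Lemma condE_tower f z : condE r' (condE r f) z = condE r' f z.
Proof. by rewrite /condE cmass_condE. Qed.

End Tower.

(** This is the coarsest case of [cmass_condE], where [r'] relates all points. *)
Lemma expect_condE r f : equivalence_rel r ->
  \sum_x p x * condE r f x = \sum_x p x * f x.
Proof.
move=> req; case: (pickP I) => [z _|I0]; last by rewrite !big_pred0.
by have := @cmass_condE r (fun _ _ => true) req (fun _ _ _ => conj isT (fun=> erefl))
  (fun _ _ _ => isT) f z.
Qed.

Lemma condE_hoeffding r a h z : equivalence_rel r -> 0 <= h -> 0 < p z ->
  (forall x y, r z x -> r z y -> 0 < p x -> 0 < p y -> a x - a y <= h) ->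
  condE r (expR \o a) z <= expR (condE r a z + h ^+ 2 / 8).
Proof.
move=> req h0 pz ah.
have rr : reflexive r by case/equivalence_relP: req.
have m0 := cmass1_gt0 rr pz.
set mz := cmass r (fun=> 1) z in m0 *.
pose q x := (if r z x then p x else 0) / mz.
have qE (g : I -> R) : condE r g z = \sum_x q x * g x.
  rewrite /condE /cmass big_mkcond/= mulr_suml; apply: eq_bigr => x _.
  by rewrite /q; case: ifP => _; rewrite ?mul0r// mulrAC.
have q0 x : 0 <= q x by rewrite divr_ge0 ?(ltW m0)//; case: ifP.
have q1 : \sum_x q x = 1.
  have := qE (fun=> 1); rewrite /condE divff ?gt_eqF// => ->.
  by apply: eq_bigr => x _; rewrite mulr1.
have qpos x : q x != 0 -> r z x /\ 0 < p x.
  rewrite /q; case: ifP => [zx|]; last by rewrite mul0r eqxx.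
  rewrite mulf_eq0 negb_or => /andP[px _]; split => //.
  by rewrite lt_neqAle eq_sym px p_ge0.
have zA : q z != 0 by rewrite /q rr mulf_neq0// gt_eqF// invr_gt0.
(* The lower end of Hoeffding's interval is the minimum of [a] over the points of positive
   conditional weight. *)
case: (arg_minP (P := fun x => q x != 0) a zA) => i qi imin.
rewrite !qE; apply: (@hoeffding_lemma _ _ _ _ (a i)) => // x qx.
rewrite imin//= -lerBlDl.
by have [? ?] := qpos _ qi; have [? ?] := qpos _ qx; exact: ah.
Qed.

(** One martingale step: by the tower property, given [r'], the variable [s * condE r f] has mean
    [s * condE r' f], and it ranges over an interval of length [s * h]. *)
Lemma mgf_condE_step r r' f (s h : R) :
  equivalence_rel r -> equivalence_rel r' -> subrel r r' -> 0 <= s -> 0 <= h ->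
  (forall x y, r' x y -> 0 < p x -> 0 < p y -> condE r f x - condE r f y <= h) ->
  \sum_x p x * expR (s * condE r f x) <=
  expR (s ^+ 2 * h ^+ 2 / 8) * \sum_x p x * expR (s * condE r' f x).
Proof.
move=> req req' rr' s0 h0 osc.
rewrite -(expect_condE _ req') mulr_sumr; apply: ler_sum => x _.
have [->|px] := eqVneq (p x) 0; first by rewrite !mul0r mulr0.
have {}px : 0 < p x by rewrite lt_neqAle eq_sym px p_ge0.
rewrite [leRHS]mulrCA ler_wpM2l// -expRD addrC -exprMn.
rewrite -(condE_tower req req' rr' f) -condE_scale.
apply: (@condE_hoeffding _ (fun y => s * condE r f y)) => //.
  exact: mulr_ge0.
move=> u v xu xv pu pv; rewrite -mulrBr ler_wpM2l// osc//.
by have [_ /(_ xu) <-] := req' x u v.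
Qed.

Lemma chernoff_bound f (s u : R) : 0 <= s ->
  \sum_(x | u <= f x) p x <= expR (- (s * u)) * \sum_x p x * expR (s * f x).
Proof.
move=> s0; rewrite mulr_sumr big_mkcond/=; apply: ler_sum => x _.
case: ifPn => [uf|_]; last by rewrite !mulr_ge0 ?expR_ge0.
rewrite mulrCA -expRD -[leLHS]mulr1 ler_wpM2l// -expR0 ler_expR.
by rewrite addrC -mulrBr mulr_ge0 ?subr_ge0.
Qed.

End FiniteConditioning.

(** * Independent blocks of coordinates *)

Section BlockProduct.
Variables (R : realType) (W V K : finType) (b : W -> V).
Implicit Types (U A N Q : {set V}) (i : V) (z : {ffun W -> K}).

(** The map [b] sends a coordinate to its block. The classes of [agree U] are the atoms of the
    sigma-algebra generated by the blocks in [U], so [condE p (agree U)] conditions on these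
    blocks. *)
Definition agree U : rel {ffun W -> K} :=
  fun z z' => [forall w, (b w \in U) ==> (z w == z' w)].

Definition glue U z z' : {ffun W -> K} :=
  [ffun w => if b w \in U then z w else z' w].

(** Measurability with respect to the blocks in [U], in the finite setting. *)
Definition determined (X : Type) U (g : {ffun W -> K} -> X) :=
  forall z z', agree U z z' -> g z = g z'.

Lemma agreeP U z z' :
  reflect (forall w, b w \in U -> z w = z' w) (agree U z z').
Proof.
apply: (iffP forallP) => h w; first by move=> wU; exact/eqP/(implyP (h w)).
by apply/implyP => wU; apply/eqP/h.
Qed.

Lemma agree_equiv U : equivalence_rel (agree U).
Proof.
apply/equivalence_relP; split=> [z|z z' zz' z'']; first exact/agreeP.
apply/agreeP/agreeP => h w wU; rewrite -?h//.
  by rewrite (agreeP _ _ _ zz').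
by rewrite (agreeP _ _ _ zz')// h.
Qed.

Lemma agreexx U z : agree U z z. Proof. exact/agreeP. Qed.

Lemma agreeC U z z' : agree U z z' = agree U z' z.
Proof. by apply/agreeP/agreeP => h w /h. Qed.

Lemma agreeW U U' z z' : U \subset U' -> agree U' z z' -> agree U z z'.
Proof. by move=> /fintype.subsetP UU' /agreeP h; apply/agreeP => w /UU'/h. Qed.

Lemma agreeU U U' z z' :
  agree (U :|: U') z z' = agree U z z' && agree U' z z'.
Proof.
apply/idP/andP => [h|[/agreeP h /agreeP h']].
  by split; apply: agreeW h; rewrite ?finset.subsetUl ?finset.subsetUr.
by apply/agreeP => w; rewrite inE => /orP[/h|/h'].
Qed.

Lemma agree_congr U x y : agree U x y -> agree U x =1 agree U y.
Proof. by move=> xy z; have [_ /(_ xy)] := agree_equiv U x y z. Qed.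

Variable p : {ffun W -> K} -> R.
Hypothesis p_ge0 : forall z, 0 <= p z.

Definition block_indep U U' := forall E E' : pred {ffun W -> K},
  determined U E -> determined U' E' ->
  \sum_(z | E z && E' z) p z = (\sum_(z | E z) p z) * \sum_(z | E' z) p z.

(** [g] factors through [rep], which keeps the blocks in [U'] and freezes the others; independence
    is applied to each event [rep z == y]. *)
Lemma block_indep_expect U U' (E : pred {ffun W -> K}) (g : {ffun W -> K} -> R) :
  block_indep U U' -> determined U E -> determined U' g ->
  \sum_(z | E z) p z * g z = (\sum_(z | E z) p z) * \sum_z p z * g z.
Proof.
move=> UU' dE dg; case: (pickP {ffun W -> K}) => [z0 _|I0]; last first.
  by rewrite big1 ?[in RHS]big1 ?mul0r// => z; have := I0 z.
pose rep z := glue U' z z0.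
have drep : determined U' rep.
  move=> z z' /agreeP h; apply/ffunP => w; rewrite !ffunE.
  by case: ifP => // /h.
have g_rep z : g z = g (rep z).
  by apply: dg; apply/agreeP => w wU; rewrite ffunE wU.
rewrite (partition_big rep xpredT)//=.
rewrite [X in _ = _ * X](partition_big rep xpredT)//=.
rewrite mulr_sumr; apply: eq_bigr => y _.
transitivity ((\sum_(z | E z && (rep z == y)) p z) * g y).
  by rewrite mulr_suml; apply: eq_bigr => z /andP[_ /eqP <-]; rewrite -g_rep.
rewrite (UU' E (fun z => rep z == y))//; last by move=> z z' /drep ->.
rewrite -mulrA; congr (_ * _); rewrite mulr_suml.
by apply: eq_bigr => z /eqP <-; rewrite -g_rep.
Qed.

(* Independence of the blocks [A] and [~: (A :|: N)] removes the conditioning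
   on [A] from the law of the blocks outside [A :|: N]. *)
Lemma condE_glue A N Q (g : {ffun W -> K} -> R) z :
  block_indep A (~: (A :|: N)) -> A \subset Q -> [disjoint N & Q]%B ->
  determined (~: N) g -> 0 < p z ->
  condE p (agree Q) g z =
  (\sum_(y | agree (Q :\: A) z y) p y * g (glue A z y)) /
  \sum_(y | agree (Q :\: A) z y) p y.
Proof.
move=> AN AQ NQ dg pz.
have QE y : agree Q z y = agree A z y && agree (Q :\: A) z y.
  rewrite -agreeU; congr (agree _ _ _); apply/setP => v; rewrite !inE.
  by case vA: (v \in A) => //=; exact: (fintype.subsetP AQ).
have sQA : Q :\: A \subset ~: (A :|: N).
  apply/fintype.subsetP => v; rewrite !inE negb_or => /andP[-> vQ]/=.
  by apply/negP => vN; rewrite (disjointFr NQ vN) in vQ.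
(* Numerator and denominator both split off the mass of the [A]-class of [z], which then cancels.
   The remaining factor depends only on blocks outside [A :|: N], because [glue] overwrites [A] and
   [k] ignores [N]. *)
have massE (k : {ffun W -> K} -> R) : determined (~: N) k ->
    cmass p (agree Q) k z = (\sum_(y | agree A z y) p y) *
      \sum_(y | agree (Q :\: A) z y) p y * k (glue A z y).
  move=> dk; rewrite [X in _ = _ * X]big_mkcond/=.
  transitivity (\sum_(y | agree A z y)
      p y * (if agree (Q :\: A) z y then k (glue A z y) else 0)).
    rewrite /cmass big_mkcond [RHS]big_mkcond/=; apply: eq_bigr => y _.
    rewrite QE; have [Ay|//] := boolP (agree A z y).
    rewrite andTb; case: ifP => _; last by rewrite mulr0.
    congr (_ * k _); apply/ffunP => w; rewrite ffunE.
    by case: ifP => // wA; rewrite (agreeP _ _ _ Ay).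
  rewrite (block_indep_expect AN).
  - congr (_ * _); apply: eq_bigr => y _; case: ifP => //; by rewrite mulr0.
  - by move=> y y' /agree_congr h; rewrite agreeC h agreeC.
  - move=> y y' yy'; have := agree_congr (agreeW sQA yy') z.
    rewrite !(agreeC _ _ z) => ->; case: ifP => // _; apply: dk.
    apply/agreeP => w; rewrite !ffunE inE => wN; case: ifP => // wA.
    by apply: (agreeP _ _ _ yy'); rewrite !inE wA.
rewrite /condE massE// [in X in _ / X]massE//.
have mA : 0 < \sum_(y | agree A z y) p y.
  rewrite (bigD1 z) ?agreexx//= ltr_pwDl//; exact: sumr_ge0.
under [in X in _ / (_ * X)]eq_bigr do rewrite mulr1.
by rewrite invfM mulrACA divff ?mul1r// gt_eqF.
Qed.

(** Let [g] be the minimum of [f] over the blocks [i] and [N], so that [g <= f <= g + h]. As [g]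
    ignores these blocks, its conditional expectation given [Q] does not depend on block [i], and
    [f] inherits an oscillation of at most [h]. *)
Lemma condE_oscillation A N Q i f h x y :
  block_indep A (~: (A :|: N)) -> i \in A -> A \subset Q -> [disjoint N & Q]%B ->
  (forall z z', agree (~: (i |: N)) z z' -> f z - f z' <= h) ->
  agree (Q :\ i) x y -> 0 < p x -> 0 < p y ->
  condE p (agree Q) f x - condE p (agree Q) f y <= h.
Proof.
move=> AN iA AQ NQ osc xy px py.
pose C := ~: (i |: N).
pose g z := f [arg min_(z' < z | agree C z z') f z']%O.
have g_le z z' : agree C z z' -> g z <= f z'.
  move=> zz'; rewrite /g; case: arg_minP => [|u _]; first exact: agreexx.
  exact.
have g_attained z : exists2 u, agree C z u & g z = f u.
  rewrite /g; case: arg_minP => [|u zu _]; first exact: agreexx.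
  by exists u.
have f_le z : f z <= g z + h.
  by have [u zu ->] := g_attained z; rewrite -lerBlDl osc.
have dg : determined C g.
  suff le z z' : agree C z z' -> g z <= g z'.
    by move=> z z' zz'; apply/le_anti; rewrite !le// agreeC.
  move=> zz'; have [u z'u ->] := g_attained z'.
  by apply: g_le; rewrite (agree_congr zz').
have dgN : determined (~: N) g.
  move=> z z' zz'; apply: dg; apply: agreeW zz'.
  by rewrite finset.setCS finset.subsetUr.
(* By [condE_glue], block [i], which lies in [A], enters only through the values glued into [g], and
   [g] ignores it. The other blocks of [Q] agree at [x] and [y]. *)
have gE : condE p (agree Q) g x = condE p (agree Q) g y.
  rewrite !(condE_glue AN)//.
  have e : agree (Q :\: A) x =1 agree (Q :\: A) y.
    apply: agree_congr; apply: agreeW xy; apply/fintype.subsetP => v.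
    rewrite !inE => /andP[vA ->]; rewrite andbT.
    by apply: contraNneq vA => ->.
  congr (_ / _); last exact: eq_bigl.
  apply: eq_big => // u _; congr (_ * _); apply: dg.
  apply/agreeP => w; rewrite !ffunE !inE negb_or => /andP[wi _].
  case: ifP => // wA; apply: (agreeP _ _ _ xy).
  by rewrite !inE wi (fintype.subsetP AQ).
have le1 : condE p (agree Q) f x <= condE p (agree Q) g x + h.
  rewrite -condE_add_const//; last exact: agreexx.
  exact: condE_le.
have le2 : condE p (agree Q) g y <= condE p (agree Q) f y.
  by apply: condE_le => // z; apply: g_le; exact: agreexx.
lra.
Qed.

End BlockProduct.

(** * Elimination of the vertices of a forest *)

Lemma ler_sum_addl (R : numDomainType) (I : finType) (P Q : pred I) (g : I -> R)
    (i : I) :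
  (forall j, 0 <= g j) -> subpred P Q -> Q i -> ~~ P i ->
  \sum_(j | P j) g j + g i <= \sum_(j | Q j) g j.
Proof.
move=> g0 PQ Qi Pi; rewrite [leRHS](bigD1 i)//= [leLHS]addrC lerD2l.
rewrite big_mkcond [leRHS]big_mkcond/=; apply: ler_sum => j _.
case: ifPn => Pj; last by case: ifP.
by rewrite PQ//=; case: eqVneq Pj Pi => // -> ->.
Qed.

Lemma ler_sum_subpred (R : numDomainType) (I : finType) (P Q : pred I)
    (g : I -> R) :
  (forall j, 0 <= g j) -> subpred P Q ->
  \sum_(j | P j) g j <= \sum_(j | Q j) g j.
Proof.
move=> g0 PQ; rewrite big_mkcond [leRHS]big_mkcond/=; apply: ler_sum => j _.
case: ifPn => Pj; last by case: ifP.
by rewrite PQ.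
Qed.

Section ForestElimination.
Variables (V : finType) (F : sgraph V).
Hypothesis F_forest : forest F.
Implicit Types Q A N : {set V}.

Definition restrict_rel Q : rel V := [rel x y | [&& x \in Q, y \in Q & F x y]].

(* Each connected component of the subgraph induced by [Q] has at most one edge
   leaving [Q]. *)
Definition pendant Q := forall u v x y, u \in Q -> v \in Q ->
  x \notin Q -> y \notin Q -> F u x -> F v y ->
  connect (restrict_rel Q) u v -> u = v /\ x = y.

Lemma restrict_rel_sym Q : symmetric (restrict_rel Q).
Proof. by move=> x y; rewrite /restrict_rel/= (adj_sym F x y) andbCA. Qed.

Lemma restrict_connect_sym Q : connect_sym (restrict_rel Q).
Proof. exact/sym_connect_sym/restrict_rel_sym. Qed.

Lemma restrict_connect_mem Q u v :
  u \in Q -> connect (restrict_rel Q) u v -> v \in Q.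
Proof.
move=> uQ /connectP[s + ->]; elim: s u uQ => //= w s IH u uQ /andP[/and3P[_ wQ _]].
exact: IH.
Qed.

Lemma restrict_connectS Q Q' : Q \subset Q' ->
  subrel (connect (restrict_rel Q)) (connect (restrict_rel Q')).
Proof.
move=> /fintype.subsetP QQ'; apply: connect_sub => x y /and3P[xQ yQ xy].
by apply: connect1; rewrite /restrict_rel/= !QQ'.
Qed.

Lemma restrict_connect_adj Q : subrel (connect (restrict_rel Q)) (connect F).
Proof. by apply: connect_sub => x y /and3P[_ _ xy]; exact: connect1. Qed.

Lemma pendantT : pendant [set: V]%SET.
Proof. by move=> u v x y _ _; rewrite inE. Qed.

(** A path inside [Q] between two distinct neighbours of [i] would close up to a cycle through
    [i]. *)
Lemma forest_unique_neighbor Q i u v : i \notin Q -> u \in Q ->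
  F i u -> F i v -> connect (restrict_rel Q) u v -> u = v.
Proof.
move=> iQ uQ iu iv /connectP[s us vE]; apply/eqP/negP => /negP uv.
have sQ : {subset u :: s <= Q}.
  move=> w ws; apply: (@restrict_connect_mem Q u) => //.
  exact: (path_connect us).
case/shortenP: us vE => s' us' us'_uniq s's vE.
have s'Q : {subset u :: s' <= Q}.
  by move=> w; rewrite inE => /predU1P[->//|/s's ws]; apply: sQ; rewrite inE ws orbT.
apply: (F_forest (s := i :: u :: s')).
  (* The cycle has at least three vertices, since an empty [s'] would force [u = v]. *)
  by case: s' vE {us' us'_uniq s's s'Q} => //= vE; rewrite vE eqxx in uv.
apply/andP; split.
  rewrite /= rcons_path iu -vE (adj_sym F) iv andbT/=.
  by apply: sub_path us' => x y /and3P[].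
by rewrite cons_uniq us'_uniq andbT; apply: contra iQ => /s'Q.
Qed.

(** The only new exits lead to [i]. Two of them from one component coincide by
    [forest_unique_neighbor]; one of them together with an old exit would give the component of [i]
    in [Q] an exit at a vertex other than [i]. *)
Lemma pendant_remove Q i : pendant Q -> i \in Q ->
  (forall v x, connect (restrict_rel Q) i v -> x \notin Q -> F v x -> v = i) ->
  pendant (Q :\ i).
Proof.
move=> pQ iQ exit_i u v x y.
rewrite !in_setD1 => /andP[ui uQ] /andP[vi vQ] xQ yQ ux vy uv.
have uvQ : connect (restrict_rel Q) u v.
  by apply: restrict_connectS uv; exact: finset.subD1set.
have no_exit w w' z : w \in Q -> w' \in Q -> w' != i -> F w i -> z \notin Q ->
    F w' z -> connect (restrict_rel Q) w w' -> False.
  move=> wQ w'Q w'i wi zQ w'z ww'.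
  suff /exit_i : connect (restrict_rel Q) i w'.
    by move=> /(_ _ zQ w'z) w'E; rewrite w'E eqxx in w'i.
  apply: connect_trans ww'; apply: connect1.
  by rewrite /restrict_rel/= iQ wQ (adj_sym F).
move: xQ yQ; rewrite !negb_and !negbK.
move=> /orP[/eqP xi|xQ] /orP[/eqP yi|yQ].
- rewrite xi yi; split => //.
  apply: (@forest_unique_neighbor (Q :\ i) i) => //.
  + by rewrite !inE eqxx.
  + by rewrite !inE ui.
  + by rewrite (adj_sym F) -xi.
  + by rewrite (adj_sym F) -yi.
- by exfalso; apply: (no_exit u v y) => //; rewrite -xi.
- exfalso; apply: (no_exit v u x) => //; first by rewrite -yi.
  by rewrite restrict_connect_sym.
- exact: (pQ u v x y).
Qed.

(** A component of [Q] without exits is closed under adjacency in the whole forest. *)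
Lemma restrict_component_tree Q u : u \in Q ->
  (forall v x, connect (restrict_rel Q) u v -> x \notin Q -> ~~ F v x) ->
  [set v | connect (restrict_rel Q) u v]%SET \in trees F.
Proof.
move=> uQ no_exit; apply/imsetP; exists u => //.
apply/setP => v; rewrite !inE; apply/idP/idP; first exact: restrict_connect_adj.
pose a := [pred v | connect (restrict_rel Q) u v].
have cl : fingraph.closed F a.
  apply: intro_closed; first exact/sym_connect_sym/adj_sym.
  move=> x y xy; rewrite !inE => ux.
  have xQ := restrict_connect_mem uQ ux.
  have yQ : y \in Q by apply/negPn/negP => /(no_exit _ _ ux); rewrite xy.
  by apply: connect_trans ux _; apply: connect1; rewrite /restrict_rel/= xQ yQ.
by move=> uv; have := closed_connect cl uv; rewrite !inE connect0.
Qed.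

Variables (R : realType) (W K : finType) (b : W -> V) (p : {ffun W -> K} -> R).
Hypothesis p_ge0 : forall z, 0 <= p z.
Hypothesis p_sum1 : \sum_z p z = 1.
Hypothesis p_indep : forall U U' : {set V}, [disjoint U & U']%B ->
  (forall u v, u \in U -> v \in U' -> ~~ F u v) -> block_indep b p U U'.
Variables (c : V -> R) (rt : {set V} -> V) (f : {ffun W -> K} -> R).
Hypothesis rt_tree : forall A, A \in trees F -> rt A \in A.
Hypothesis f_lip : forall (U : {set V}) z z', agree b (~: U) z z' ->
  f z - f z' <= \sum_(u in U) c u.
Hypothesis c_ge0 : forall v, 0 <= c v.

(* The part of the weight of the forest paid for the blocks revealed in [Q]. *)
Let Phi Q := \sum_(A in trees F | A \subset Q) c (rt A) ^+ 2 +
  \sum_(e in edges F | ~~ [disjoint e & Q]%B) (\sum_(u in e) c u) ^+ 2.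

(** Take a component [A] of [Q]. If an edge joins some [i] in [A] to some [x] outside [Q], then
    removing [i] takes that edge out of [Phi] and pays for [h = c i + c x]. Otherwise [A] is a whole
    tree; removing its root takes the tree out of [Phi] and pays for [h = c (rt A)]. *)
Lemma elimination_step Q : pendant Q -> Q != finset.set0 ->
  exists i, i \in Q /\ pendant (Q :\ i) /\ exists h, [/\ 0 <= h,
    forall x y, agree b (Q :\ i) x y -> 0 < p x -> 0 < p y ->
      condE p (agree b Q) f x - condE p (agree b Q) f y <= h &
    Phi (Q :\ i) + h ^+ 2 <= Phi Q].
Proof.
move=> pQ /set0Pn[u0 u0Q].
pose A := [set v | connect (restrict_rel Q) u0 v]%SET.
have AQ : A \subset Q.
  by apply/fintype.subsetP => v; rewrite inE; exact: restrict_connect_mem.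
(* No edge leaves [A] inside [Q], so a set [N] containing the outer ends of all exits separates [A]
   from the remaining blocks. *)
have A_nbr N : (forall v x, v \in A -> x \notin Q -> F v x -> x \in N) ->
    block_indep b p A (~: (A :|: N)).
  move=> exitN; apply: p_indep.
    by rewrite finset.disjoints_subset finset.setCK finset.subsetUl.
  move=> u v uA; rewrite !inE negb_or => /andP[vA vN]; apply/negP => uv.
  have [vQ|vQ] := boolP (v \in Q); last by rewrite (exitN u v) in vN; rewrite ?uA.
  have uQ := fintype.subsetP AQ _ uA.
  move/negP: vA; apply; rewrite inE in uA; apply: connect_trans uA _.
  by apply: connect1; rewrite /restrict_rel/= uQ vQ uv.
have A_conn i v : i \in A -> connect (restrict_rel Q) i v -> v \in A.
  by rewrite !inE => u0i; exact: connect_trans.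
have treesS : forall i, {in trees F, forall T : {set V}, T \subset Q :\ i -> T \subset Q}.
  by move=> i T _ /fintype.subset_trans; apply; exact: finset.subD1set.
have edgesS i (e : {set V}) : ~~ [disjoint e & Q :\ i]%B -> ~~ [disjoint e & Q]%B.
  by apply: contra => eQ; apply: disjointWr eQ; exact: finset.subD1set.
have [exitA|] := boolP [exists i in A, exists x, (x \notin Q) && F i x].
  have /exists_inP[i iA /existsP[x /andP[xQ ix]]] := exitA.
  have iQ := fintype.subsetP AQ _ iA.
  have exit_unique v y : v \in A -> y \notin Q -> F v y -> v = i /\ y = x.
    move=> vA yQ vy; apply: (pQ v i y x) => //.
      exact: (fintype.subsetP AQ).
    move: vA iA; rewrite !inE restrict_connect_sym; exact: connect_trans.
  exists i; split => //; split.
    apply: pendant_remove => // v y iv yQ vy.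
    by have [] := exit_unique v y (A_conn _ _ iA iv) yQ vy.
  have ixV : x != i by apply: contraNneq xQ => ->.
  exists (c i + c x); split; first exact: addr_ge0.
    move=> y z; apply: (@condE_oscillation _ _ _ _ _ _ p_ge0 A [set x]%SET) => //.
    - apply: A_nbr => v w vA wQ vw; rewrite inE.
      by have [_ ->] := exit_unique _ _ vA wQ vw.
    - by rewrite disjoints1.
    - move=> z1 z2 /f_lip; rewrite big_setU1 ?big_set1//=.
      by rewrite inE eq_sym.
  rewrite /Phi -addrA lerD//.
    apply: ler_sum_subpred => [T|T /andP[Tt TQ]]; first exact: sqr_ge0.
    by rewrite Tt (treesS i).
  have <- : \sum_(u in [set i; x]%SET) c u = c i + c x.
    by rewrite big_setU1 ?big_set1//= inE eq_sym.
  apply: (ler_sum_addl (g := fun e : {set V} => (\sum_(u in e) c u) ^+ 2)).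
  - by move=> e; exact: sqr_ge0.
  - by move=> e /andP[-> /edgesS].
  - apply/andP; split.
      by apply/imsetP; exists (i, x); rewrite // inE.
    by apply/pred0Pn; exists i; rewrite /= !inE eqxx iQ.
  - rewrite negb_and negbK; apply/orP; right; apply/pred0P => w /=.
    by rewrite !inE; case: eqVneq => [->|_]; case: eqVneq => //= ->; apply/negbTE.
rewrite negb_exists_in => /forall_inP no_exit.
have {}no_exit v x : v \in A -> x \notin Q -> ~~ F v x.
  by move=> /no_exit/existsPn/(_ x); rewrite negb_and => /orP[/negP|].
have At : A \in trees F.
  apply: restrict_component_tree => // v x u0v xQ; apply: no_exit => //.
  by rewrite inE.
have rA := rt_tree At; have rQ := fintype.subsetP AQ _ rA.
exists (rt A); split => //; split.
  apply: pendant_remove => // v x /(A_conn _ _ rA) vA xQ.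
  by rewrite (negbTE (no_exit _ _ vA xQ)).
exists (c (rt A)); split => //.
  move=> y z; apply: (@condE_oscillation _ _ _ _ _ _ p_ge0 A finset.set0) => //.
  - by apply: A_nbr => v w vA wQ; rewrite (negbTE (no_exit _ _ vA wQ)).
  - by rewrite finset.disjoints_subset finset.sub0set.
  - by move=> z1 z2 /f_lip; rewrite finset.setU0 big_set1.
rewrite /Phi addrAC lerD//.
  apply: (ler_sum_addl (g := fun T => c (rt T) ^+ 2)).
  - by move=> e; exact: sqr_ge0.
  - by move=> T /andP[Tt TQ]; rewrite Tt (treesS (rt A)).
  - by rewrite At.
  - rewrite negb_and; apply/orP; right; apply/negP => /fintype.subsetP/(_ _ rA).
    by rewrite !inE eqxx.
apply: ler_sum_subpred => [e|e /andP[-> /edgesS]]//; exact: sqr_ge0.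
Qed.

Lemma condE_agree0 z : condE p (agree b finset.set0) f z = \sum_x p x * f x.
Proof.
have a0 : agree b finset.set0 z =1 xpredT.
  by move=> y; apply/agreeP => w; rewrite inE.
rewrite /condE /cmass !(eq_bigl _ _ a0).
by under [X in _ / X]eq_bigr do rewrite mulr1; rewrite p_sum1 divr1.
Qed.

(** Induction on the number of revealed blocks: each removal costs the factor of [mgf_condE_step],
    covered by the decrease of [Phi]. *)
Lemma mgf_pendant s Q : 0 <= s -> pendant Q ->
  \sum_x p x * expR (s * condE p (agree b Q) f x) <=
  expR (s ^+ 2 * Phi Q / 8 + s * \sum_x p x * f x).
Proof.
move=> s0; have [k] := ubnP #|Q|; elim: k Q => // k IH Q Qk pQ.
have [Q0|Q0] := eqVneq Q finset.set0.
  rewrite Q0 (eq_bigr (fun x => p x * expR (s * \sum_y p y * f y))); last first.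
    by move=> x _; rewrite condE_agree0.
  rewrite -mulr_suml p_sum1 mul1r ler_expR lerDr divr_ge0// mulr_ge0 ?sqr_ge0//.
  by rewrite addr_ge0//; apply: sumr_ge0 => *; exact: sqr_ge0.
have [i [iQ [pQi [h [h0 osc Phi_le]]]]] := elimination_step pQ Q0.
have {}IH := IH (Q :\ i) _ pQi.
apply: (@le_trans _ _ (expR (s ^+ 2 * h ^+ 2 / 8) *
  \sum_x p x * expR (s * condE p (agree b (Q :\ i)) f x))).
  apply: mgf_condE_step => //; [exact: agree_equiv|exact: agree_equiv|].
  by move=> x y; apply: agreeW; exact: finset.subD1set.
apply: (@le_trans _ _ (expR (s ^+ 2 * h ^+ 2 / 8) *
  expR (s ^+ 2 * Phi (Q :\ i) / 8 + s * \sum_x p x * f x))).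
  rewrite ler_wpM2l ?expR_ge0// IH//.
  by move: Qk; rewrite (cardsD1 i Q) iQ.
rewrite -expRD ler_expR addrA lerD2r -mulrDl -mulrDr.
by rewrite ler_wpM2r// ler_wpM2l ?sqr_ge0// addrC.
Qed.

(** The parameter [s] stays free: its optimal value divides by the weight, which may be 0. *)
Lemma forest_tail s u : 0 <= s ->
  \sum_(x | u + \sum_y p y * f y <= f x) p x <=
  expR (- (s * u) + s ^+ 2 * (\sum_(A in trees F) c (rt A) ^+ 2 +
    \sum_(e in edges F) (\sum_(v in e) c v) ^+ 2) / 8).
Proof.
move=> s0; apply: le_trans (chernoff_bound p_ge0 f _ s0) _.
set m := \sum_x p x * f x.
(* With all blocks revealed the classes are singletons, so conditioning returns [f] wherever [p] is
   nonzero. *)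
have -> : \sum_x p x * expR (s * f x) =
    \sum_x p x * expR (s * condE p (agree b [set: V]%SET) f x).
  apply: eq_bigr => x _.
  have [->|px] := eqVneq (p x) 0; first by rewrite !mul0r.
  have aT : agree b [set: V]%SET x =1 pred1 x.
    move=> y; apply/agreeP/eqP => [h|-> //].
    by apply/ffunP => w; rewrite h.
  by rewrite /condE /cmass !(big_pred1 x)// mulr1 mulrAC divff// mul1r.
have PhiE : Phi [set: V]%SET <= \sum_(A in trees F) c (rt A) ^+ 2 +
    \sum_(e in edges F) (\sum_(v in e) c v) ^+ 2.
  by apply: lerD; apply: ler_sum_subpred => [?|? /andP[]//]; exact: sqr_ge0.
apply: le_trans (ler_wpM2l (expR_ge0 _) (mgf_pendant s0 pendantT)) _.
by rewrite -expRD ler_expR -/m; have := ler_wpM2l (sqr_ge0 s) PhiE; lra.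
Qed.

End ForestElimination.

(** * Polish spaces *)

Section SmallSets.
Context (d : measure_display) (Om : measurableType d) (R : realType).
Variable mu : probability Om R.

(** Continuity from above along the decreasing sets [V N], whose intersection is empty. *)
Lemma exhaustion_small (H : (set Om)^nat) (e : R) :
  (forall k, measurable (H k)) -> nondecreasing_seq H -> 0 < e ->
  exists N, (mu (\bigcup_k H k `\` H N) <= e%:E)%E.
Proof.
move=> mH ndH e0.
pose V N := \bigcup_k H k `\` H N.
have mV N : measurable (V N) by apply: measurableD => //; exact: bigcupT_measurable.
have V0 : \bigcap_N V N = set0.
  by rewrite -subset0 => x Vx; have [[k _ Hkx] _] := Vx 0%N I; have [] := Vx k I.
have cV : (mu \o V) @ \oo --> 0%E.
  rewrite -(measure0 mu) -V0; apply: nonincreasing_cvg_mu => //.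
  - by apply: le_lt_trans (probability_le1 mu (mV 0%N)) _; rewrite ltry.
  - by rewrite V0.
  - move=> m n mn; apply/subsetPset; apply: setDS.
    by have /subsetPset := ndH _ _ mn.
have [N _ /(_ N (leqnn N))/= VN] : \forall N \near \oo, (mu (V N) <= e%:E)%E.
  move/fine_cvgP : cV => [finV /cvgrPdist_le/(_ _ e0) cV].
  near=> N.
  have fN : mu (V N) \is a fin_num by near: N.
  rewrite -(fineK fN) lee_fin.
  have : `|0 - fine (mu (V N))| <= e by near: N.
  by rewrite sub0r normrN ger0_norm// fine_ge0.
by exists N.
Unshelve. all: by end_near. Qed.

Lemma bigcap_small (B : (set Om)^nat) (e : R) :
  (forall k, measurable (B k)) -> 0 <= e ->
  (forall k, (mu (~` B k) <= (e / (2 ^ k.+1)%:R)%:E)%E) ->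
  (mu (~` \bigcap_k B k) <= e%:E)%E.
Proof.
move=> mB e0 Be; rewrite setC_bigcap.
have mC k : measurable (~` B k) by exact: measurableC.
apply: (@le_trans _ _ (\sum_(k <oo) (e / (2 ^ k.+1)%:R)%:E)%E); last first.
  exact: (epsilon_trick0 xpredT).
apply: le_trans.
  apply: (measure_sigma_subadditive mu mC _ (@subset_refl _ _)).
  exact: bigcupT_measurable.
by apply: lee_nneseries => // k _; exact: Be.
Qed.

Lemma setI_small (A B : set Om) (a b : R) : measurable A -> measurable B ->
  (mu (~` A) <= a%:E)%E -> (mu (~` B) <= b%:E)%E ->
  (mu (~` (A `&` B)) <= (a + b)%:E)%E.
Proof.
move=> mA mB Aa Bb; rewrite setCI EFinD.
apply: le_trans (leeD Aa Bb); apply: measureU2; exact: measurableC.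
Qed.

End SmallSets.

Section PolishMetric.
Variable R : realType.

(** Polishness only asserts that a metric and a countable dense set exist; here they are data, the
    dense set being enumerated as a sequence. *)
Record polish_metric (T : ptopologicalType) := PolishMetric {
  pdist : T -> T -> R;
  pseq : nat -> T;
  pdist_eq0 : forall x y, pdist x y = 0 <-> x = y;
  pdistC : forall x y, pdist x y = pdist y x;
  pdist_tri : forall x y z, pdist x z <= pdist x y + pdist y z;
  pdist_nbhs : forall (x : T) (A : set T),
    nbhs x A <-> exists2 e, 0 < e & [set y | pdist x y < e] `<=` A;
  pdist_complete : forall u : nat -> T,
    (forall e, 0 < e -> exists N, forall m n : nat,
       (N <= m)%N -> (N <= n)%N -> pdist (u m) (u n) < e) ->
    exists l : T, u @ \oo --> l;
  pseq_dense : forall x e, 0 < e -> exists k, pdist (pseq k) x < e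
}.

Lemma polish_metric_exists (T : ptopologicalType) :
  polish R T -> inhabited (polish_metric T).
Proof.
move=> [[D Dc Dd] [d [d0 dC dtri dnbhs dcompl]]].
have dge0 x y : 0 <= d x y.
  have := dtri x y x; rewrite (dC y x); have /d0 -> : x = x by []; lra.
have oB x e : open [set y | d y x < e].
  rewrite openE => y /= yx; apply/dnbhs; exists (e - d y x); first by rewrite subr_gt0.
  move=> z /= yz; apply: le_lt_trans (dtri z y x) _.
  by rewrite (dC z y) -ltrBrDr.
have [s sD] : exists s : nat -> T, forall x, D x -> exists k, s k = x.
  have /ppcard_leP[g] : (D #<= [set: nat])%card by exact: Dc.
  (* An injection of the countable set into [nat] is inverted, with the default value [point] off
     its range. *)
  exists (fun k => 'pinv_(fun=> point) D g k) => x Dx; exists (g x).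
  by rewrite pinvKV ?inE//; exact: 'inj_g.
have dense_s x e : 0 < e -> exists k, d (s k) x < e.
  move=> e0.
  have [|y [/= yx /sD[k sk]]] := Dd [set y | d y x < e] _ (oB x e).
    by exists x; rewrite /= (_ : d x x = 0)//; exact/d0.
  by exists k; rewrite sk.
by constructor; exact: (@PolishMetric _ d s).
Qed.

Variables (T : ptopologicalType) (M : polish_metric T).

Lemma pdistxx x : pdist M x x = 0. Proof. exact/pdist_eq0. Qed.

Lemma pdist_ge0 x y : 0 <= pdist M x y.
Proof. have := pdist_tri M x y x; rewrite (pdistC M y x) pdistxx; lra. Qed.

Lemma pdist_ball_open x e : open [set y | pdist M x y < e].
Proof.
rewrite openE => y /= xy; apply/(pdist_nbhs M).
exists (e - pdist M x y); first by rewrite subr_gt0.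
move=> z /= yz; apply: le_lt_trans (pdist_tri M x y z) _.
by rewrite addrC -ltrBrDr.
Qed.

Lemma open_measurable_borel (A : set (borel T)) : open (A : set T) -> measurable A.
Proof. by move=> oA; exact: sub_sigma_algebra. Qed.

(** For each radius the ultrafilter selects one of finitely many balls. Any two selected balls share
    a point of the sequence, so their centres form a Cauchy sequence, whose limit is the
    ultralimit. *)
Lemma cauchy_ultralimit (G : set_system nat) (u : nat -> T) : UltraFilter G ->
  (forall e, 0 < e -> exists N, \forall m \near G, exists2 k, (k < N)%N &
    pdist M (pseq M k) (u m) < e) ->
  exists l, forall e, 0 < e -> \forall m \near G, pdist M (u m) l < e.
Proof.
move=> UG tb.
pose eps j : R := j.+1%:R^-1.
have eps_gt0 j : 0 < eps j by rewrite invr_gt0 ltr0n.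
have ball j : exists k, \forall m \near G, pdist M (pseq M k) (u m) < eps j.
  have [N GN] := tb _ (eps_gt0 j); apply: contrapT => nk.
  (* If no ball were selected, the ultrafilter would contain the complement of any finite union of
     them. *)
  suff : forall n, \forall m \near G,
      ~ exists2 k, (k < n)%N & pdist M (pseq M k) (u m) < eps j.
    move=> /(_ N) /(filterI GN) G0.
    by have [m [? []]] := filter_ex G0.
  elim=> [|n IH]; first by apply: filterE => m [k].
  have [Gn|Gn] := in_ultra_setVsetC [set m | pdist M (pseq M n) (u m) < eps j] UG.
    by exfalso; apply: nk; exists n.
  apply: filterS2 IH Gn => m nm nn [k]; rewrite ltnS leq_eqVlt => /predU1P[->//|kn kd].
  by apply: nm; exists k.
have [c cP] := choice ball.
have inter (m n : nat) : pdist M (pseq M (c m)) (pseq M (c n)) < eps m + eps n.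
  have [q [qm qn]] := filter_ex (filterI (cP m) (cP n)).
  apply: le_lt_trans (pdist_tri M _ (u q) _) _.
  by rewrite (pdistC M (u q)) ltrD.
have eps_small e : 0 < e -> exists N, forall m, (N <= m)%N -> eps m < e.
  move=> e0; exists (Num.truncn (e^-1)) => m Nm.
  rewrite /eps invf_plt ?posrE ?ltr0n//.
  by apply: lt_le_trans (truncnS_gt _) _; rewrite ler_nat ltnS.
have [|l cl] := @pdist_complete _ M (fun n => pseq M (c n)).
  move=> e e0; have [N Ne] := eps_small (e / 2) (divr_gt0 e0 (ltr0n _ 2)).
  exists N => m n Nm Nn; apply: lt_trans (inter m n) _.
  by have := Ne _ Nm; have := Ne _ Nn; lra.
exists l => e e0.
have e2 : 0 < e / 2 by rewrite divr_gt0.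
have [N Ne] := eps_small _ e2.
have nl : nbhs l [set y | pdist M l y < e / 2].
  by apply/(pdist_nbhs M); exists (e / 2).
have [K _ Kl] := cl _ nl.
have h : pdist M l (pseq M (c (maxn N K))) < e / 2 := Kl _ (leq_maxr _ _).
have h' := Ne _ (leq_maxl N K).
apply: filterS (cP (maxn N K)) => m /= cm.
apply: le_lt_trans (pdist_tri M _ (pseq M (c (maxn N K))) _) _.
by rewrite (pdistC M (u m)) (pdistC M _ l); lra.
Qed.

End PolishMetric.

(** * Regularity of Borel measures on the product *)

Section ProductRegularity.
Variables (R : realType) (n : nat) (T : 'I_n -> ptopologicalType).
Variable M : forall i, polish_metric R (T i).

(** Closedness in the product topology, expressed through the maximum of the coordinate metrics. *)
Definition coord_closed (C : set (prod_borel T)) := forall x, ~ C x ->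
  exists2 e, 0 < e & forall y, (forall i, pdist (M i) (x i) (y i) < e) -> ~ C y.

Lemma coord_closed0 : coord_closed set0.
Proof. by move=> x _; exists 1 => // y _ []. Qed.

Lemma coord_closedU C D :
  coord_closed C -> coord_closed D -> coord_closed (C `|` D).
Proof.
move=> cC cD x /not_orP[/cC[e e0 eC] /cD[e' e'0 eD]].
exists (Num.min e e'); first by rewrite lt_min e0.
move=> y xy [|].
  by apply: eC => i; apply: lt_le_trans (xy i) _; rewrite ge_min lexx.
by apply: eD => i; apply: lt_le_trans (xy i) _; rewrite ge_min lexx orbT.
Qed.

Lemma coord_closed_bigU (C : (set (prod_borel T))^nat) N :
  (forall k, coord_closed (C k)) -> coord_closed (\big[setU/set0]_(k < N) C k).
Proof.
move=> cC; apply: (big_ind coord_closed) => //; first exact: coord_closed0.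
by move=> A B; exact: coord_closedU.
Qed.

Lemma coord_closed_bigcap (C : (set (prod_borel T))^nat) :
  (forall k, coord_closed (C k)) -> coord_closed (\bigcap_k C k).
Proof.
move=> cC x /existsNP[k /not_implyP[_ /cC[e e0 eC]]].
by exists e => // y /eC Cy /(_ k I).
Qed.

Lemma coord_closed_ultralimit (G : set_system nat) (C : set (prod_borel T))
    (u : nat -> prod_borel T) (l : prod_borel T) : ProperFilter G ->
  coord_closed C -> (\forall m \near G, C (u m)) ->
  (forall e i, 0 < e -> \forall m \near G, pdist (M i) (u m i) (l i) < e) ->
  C l.
Proof.
move=> PG cC uC ul; apply: contrapT => /cC[e e0 eC].
have : \forall m \near G, forall i, pdist (M i) (l i) (u m i) < e.
  apply: filter_forall => i; apply: filterS (ul e i e0) => m /=.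
  by rewrite pdistC.
by move=> /(filterI uC) /filter_ex[m [Cm /eC]].
Qed.

Variable mu : probability (prod_borel T) R.

(** Approximating [A] and its complement from inside at once makes the property stable under
    complement. *)
Definition coord_regular (A : set (prod_borel T)) := forall e : R, 0 < e ->
  exists C D, [/\ measurable C, measurable D, coord_closed C, coord_closed D &
    [/\ C `<=` A, D `<=` ~` A & (mu (~` (C `|` D)) <= e%:E)%E]].

Lemma coord_regularC A : coord_regular A -> coord_regular (~` A).
Proof.
move=> rA e /rA[C [D [mC mD cC cD [CA DA CD]]]].
by exists D, C; split => //; split; rewrite ?setCK// setUC.
Qed.

(** Finitely many of the closed sets [C k] already fill their union up to measure [e / 2]. *)
Lemma coord_regular_Fsigma (A : set (prod_borel T)) :
  (forall e, 0 < e -> exists (C : (set (prod_borel T))^nat) D,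
    [/\ forall k, measurable (C k) /\ coord_closed (C k) /\ C k `<=` A,
        measurable D, coord_closed D & D `<=` ~` A /\
        (mu (~` (\bigcup_k C k `|` D)) <= e%:E)%E]) ->
  coord_regular A.
Proof.
move=> rA e e0; have e2 : 0 < e / 2 by rewrite divr_gt0.
have [C [D [CP mD cD [DA CD]]]] := rA _ e2.
pose H N := \big[setU/set0]_(k < N) C k.
have mH N : measurable (H N).
  by apply: bigsetU_measurable => k _; have [] := CP k.
have ndH : nondecreasing_seq H.
  by move=> a b ab; apply/subsetPset; exact: subset_bigsetU.
have HE : \bigcup_N H N = \bigcup_k C k.
  apply/seteqP; split => x [N _]; last first.
    by move=> Cx; exists N.+1 => //; rewrite /H -bigcup_mkord; exists N => /=.
  by rewrite /H -bigcup_mkord => -[k _ Cx]; exists k.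
have [N HN] := exhaustion_small mu mH ndH e2.
have mCk : measurable (\bigcup_k C k).
  by apply: bigcupT_measurable => k; have [] := CP k.
exists (H N), D; split => //.
  by apply: coord_closed_bigU => k; have [_ []] := CP k.
split => //.
  rewrite /H -bigcup_mkord; apply: bigcup_sub => k _.
  by have [_ []] := CP k.
rewrite [e]splitr EFinD.
apply: le_trans (leeD CD HN).
apply: le_trans; last first.
  apply: measureU2; last by rewrite HE; exact: measurableD.
  by apply: measurableC; exact: measurableU.
apply: le_measure; rewrite ?inE.
- by apply: measurableC; exact: measurableU.
- apply: measurableU; first by apply: measurableC; exact: measurableU.
  by rewrite HE; exact: measurableD.
- rewrite HE => x /not_orP[xH xD]; have [xC|xC] := pselect ((\bigcup_k C k) x).
    by right.
  by left; move=> [].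
Qed.

(** The inner approximations of the [A k] form a countable union of closed sets, those of the
    complements a closed intersection; the errors sum to at most [e]. *)
Lemma coord_regular_bigcup (A : (set (prod_borel T))^nat) :
  (forall k, coord_regular (A k)) -> coord_regular (\bigcup_k A k).
Proof.
move=> rA; apply: coord_regular_Fsigma => e e0.
have {}rA k : exists CD : set (prod_borel T) * set (prod_borel T),
    [/\ measurable CD.1, measurable CD.2, coord_closed CD.1, coord_closed CD.2 &
    [/\ CD.1 `<=` A k, CD.2 `<=` ~` A k &
      (mu (~` (CD.1 `|` CD.2)) <= (e / (2 ^ k.+1)%:R)%:E)%E]].
  have [|C [D CDP]] := rA k (e / (2 ^ k.+1)%:R); last by exists (C, D).
  by rewrite divr_gt0// ltr0n expn_gt0.
have [h hP] := choice rA.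
exists (fun k => (h k).1), (\bigcap_k (h k).2); split.
- move=> k; have [mC _ cC _ [CA _ _]] := hP k; split => //; split => //.
  by move=> x /CA; exists k.
- by apply: bigcapT_measurable => k; have [] := hP k.
- by apply: coord_closed_bigcap => k; have [] := hP k.
split.
  by move=> x Dx [k _ Ax]; have [_ _ _ _ [_ DA _]] := hP k; exact: DA (Dx k I) Ax.
apply: (@le_trans _ _ (mu (~` \bigcap_k ((h k).1 `|` (h k).2)))).
  apply: le_measure; rewrite ?inE.
  - apply: measurableC; apply: measurableU.
      by apply: bigcupT_measurable => k; have [] := hP k.
    by apply: bigcapT_measurable => k; have [] := hP k.
  - apply: measurableC; apply: bigcapT_measurable => k.
    by have [mC mD _ _ _] := hP k; exact: measurableU.
  - apply: subsetC => x hx; have [xC|xC] := pselect ((\bigcup_k (h k).1) x).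
      by left.
    by right => k _; have [xk|//] := hx k I; exfalso; apply: xC; exists k.
apply: bigcap_small => [k||k]; [|exact: ltW|].
  by have [mC mD _ _ _] := hP k; exact: measurableU.
by have [_ _ _ _ []] := hP k.
Qed.

Definition cylinder i (B : set (borel (T i))) : set (prod_borel T) :=
  (fun x : forall i, T i => x i) @^-1` B.

Lemma cylinder_measurable i (B : set (borel (T i))) :
  measurable B -> measurable (cylinder B).
Proof. by move=> mB; apply: sub_sigma_algebra; exists i, B. Qed.

(** An open set of a metric space is the union of the closed sets [B' m] of points at distance at
    least 1/(m+1) from its complement. *)
Lemma coord_regular_open_cylinder i (B : set (borel (T i))) :
  open (B : set (T i)) -> coord_regular (cylinder B).
Proof.
move=> oB; apply: coord_regular_Fsigma => e e0.
pose B' (m : nat) : set (borel (T i)) :=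
  [set t | forall y, ~ B y -> m.+1%:R^-1 <= pdist (M i) t y].
exists (fun m => cylinder (B' m)), (cylinder (~` B)).
have mB := open_measurable_borel oB.
have B'B m : B' m `<=` B.
  move=> t /= Bt; apply: contrapT => /Bt; rewrite pdistxx.
  by rewrite leNgt invr_gt0 ltr0n.
have B'far m t : ~ B' m t -> exists2 y, ~ B y & pdist (M i) t y < m.+1%:R^-1.
  move=> /existsNP[y /not_implyP[By /negP]]; rewrite -ltNge; by exists y.
split.
- move=> m; split.
    apply: cylinder_measurable; rewrite -[B' m]setCK; apply: measurableC.
    apply: open_measurable_borel; rewrite openE => t /B'far[y By ty].
    apply/(pdist_nbhs (M i)); exists (m.+1%:R^-1 - pdist (M i) t y).
      by rewrite subr_gt0.
    move=> z /= tz /(_ y By); apply/negP; rewrite -ltNge.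
    apply: le_lt_trans (pdist_tri (M i) z t y) _.
    by rewrite (pdistC (M i) z) -ltrBrDr.
  split=> [x /B'far[y By ty]|]; last by move=> x /B'B.
  exists (m.+1%:R^-1 - pdist (M i) (x i) y); first by rewrite subr_gt0.
  move=> z xz /(_ y By); apply/negP; rewrite -ltNge.
  apply: le_lt_trans (pdist_tri (M i) _ (x i) _) _.
  by rewrite (pdistC (M i) (z i)) -ltrBrDr.
- by apply: cylinder_measurable; exact: measurableC.
- move=> x /contrapT Bx.
  have : nbhs (x i : T i) B by move: oB; rewrite openE; exact.
  move=> /(pdist_nbhs (M i))[r r0 rB].
  by exists r => // y xy; apply; exact: (rB _ (xy i)).
split => //.
suff -> : \bigcup_k cylinder (B' k) `|` cylinder (~` B) = setT.
  by rewrite setCT measure0 lee_fin ltW.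
rewrite -subTset => x _; have [Bx|Bx] := pselect (B (x i)); last by right.
left; have : nbhs (x i : T i) B by move: oB; rewrite openE; exact.
move=> /(pdist_nbhs (M i))[r r0 rB].
exists (Num.truncn (r^-1)) => // y By.
rewrite leNgt; apply/negP => yr; apply: By; apply: rB => /=.
apply: lt_trans yr _; rewrite invf_plt ?posrE ?ltr0n//.
exact: truncnS_gt.
Qed.

(** The regular sets form a sigma-algebra; generation is used twice, from cylinders to the product
    and from open sets to Borel sets in one coordinate. *)
Lemma measurable_coord_regular (A : set (prod_borel T)) :
  measurable A -> coord_regular A.
Proof.
have regular0 : coord_regular set0.
  move=> e e0; exists set0, setT; split => //; first exact: coord_closed0.
    by move=> x /(_ I).
  by split => //; rewrite ?setC0// set0U setCT measure0 lee_fin ltW.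
apply: smallest_sub; first split => //.
- by move=> B rB; rewrite setTD; exact: coord_regularC.
- exact: coord_regular_bigcup.
move=> _ [i [B mB ->]]; move: B mB; apply: smallest_sub; first split => //.
- by move=> B rB; rewrite setTD; exact: coord_regularC.
- move=> F rF; rewrite preimage_bigcup; exact: coord_regular_bigcup.
- by move=> B oB; exact: coord_regular_open_cylinder.
Qed.

End ProductRegularity.

(** * Nearly full sets of total boundedness and continuity; cells *)

Section LusinSets.
Variables (R : realType) (n : nat) (T : 'I_n -> ptopologicalType).
Variable M : forall i, polish_metric R (T i).
Variable mu : probability (prod_borel T) R.
Variable f : prod_borel T -> R.
Hypothesis f_meas : measurable_fun setT f.

(** Total boundedness in every coordinate, with centres in the dense sequence. *)
Definition net_bounded (K : set (prod_borel T)) := forall e, 0 < e ->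
  exists N, forall x, K x -> forall i, exists2 k, (k < N)%N &
    pdist (M i) (pseq (M i) k) (x i) < e.

(** Continuity of [f] along ultrafilters on sequences in [K]; the limit [l] is not assumed to lie in
    [K]. *)
Definition ultracontinuous (K : set (prod_borel T)) :=
  forall (G : set_system nat) (u : nat -> prod_borel T) (l : prod_borel T),
    UltraFilter G -> (forall m, K (u m)) ->
    (forall e i, 0 < e -> \forall m \near G, pdist (M i) (u m i) (l i) < e) ->
    forall e, 0 < e -> \forall m \near G, `|f (u m) - f l| < e.

Lemma cylinder_ball_measurable i k e : measurable
  (cylinder [set t | pdist (M i) (pseq (M i) k) t < e] : set (prod_borel T)).
Proof.
apply: cylinder_measurable; apply: open_measurable_borel.
exact: pdist_ball_open.
Qed.

(** Ulam's argument: for each radius 1/(m+1), finitely many balls cover every coordinate up to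
    measure [e / 2^(m+1)]. *)
Lemma net_bounded_exists (e : R) : 0 < e -> exists K,
  [/\ measurable K, net_bounded K & (mu (~` K) <= e%:E)%E].
Proof.
move=> e0.
pose H (m N : nat) : set (prod_borel T) := \bigcap_(i in [set: 'I_n])
  \bigcup_(k in `I_N) cylinder [set t | pdist (M i) (pseq (M i) k) t < m.+1%:R^-1].
have mH m N : measurable (H m N).
  apply: fin_bigcap_measurable; first exact: finite_finset.
  move=> i _; apply: fin_bigcup_measurable; first exact: finite_II.
  by move=> k _; exact: cylinder_ball_measurable.
have ndH m : nondecreasing_seq (H m).
  move=> a b ab; apply/subsetPset => x Hx i _; have [k /= ka xk] := Hx i I.
  by exists k => //=; exact: leq_trans ab.
have HT m : \bigcup_N H m N = setT.
  rewrite -subTset => x _.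
  have /choice[k kP] : forall i, exists k,
      pdist (M i) (pseq (M i) k) (x i) < m.+1%:R^-1.
    by move=> i; apply: pseq_dense; rewrite invr_gt0 ltr0n.
  exists (\max_i k i).+1 => // i _; exists (k i); last exact: kP.
  by rewrite /= ltnS leq_bigmax.
have small m : exists N, (mu (~` H m N) <= (e / (2 ^ m.+1)%:R)%:E)%E.
  have [|N] := exhaustion_small mu (mH m) (ndH m) (e := e / (2 ^ m.+1)%:R).
    by rewrite divr_gt0// ltr0n expn_gt0.
  by rewrite HT setTD; exists N.
have [N NP] := choice small.
exists (\bigcap_m H m (N m)); split.
- by apply: bigcapT_measurable => m; exact: mH.
- move=> r r0; exists (N (Num.truncn (r^-1))) => x Kx i.
  have [k /= kN xk] := Kx (Num.truncn (r^-1)) I i I; exists k => //.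
  apply: lt_trans xk _; rewrite invf_plt ?posrE ?ltr0n//.
  exact: truncnS_gt.
- by apply: bigcap_small => //; exact: ltW.
Qed.

(** As in Lusin's theorem, [K] keeps, for every rational level, only a closed part of the superlevel
    set of [f] and a closed part of its complement. The limit then lies on the side of the level
    chosen by the ultrafilter, and two rationals around [f l] enclose [f] along the sequence. *)
Lemma ultracontinuous_exists (e : R) : 0 < e -> exists K,
  [/\ measurable K, ultracontinuous K & (mu (~` K) <= e%:E)%E].
Proof.
move=> e0.
(* Integers [k] that code no rational give the empty set. *)
pose A (k : nat) : set (prod_borel T) :=
  if unpickle k is Some r then [set x | ratr r <= f x] else set0.
have mA k : measurable (A k).
  rewrite /A; case: (unpickle k) => [r|//].
  have := f_meas measurableT (measurable_itv `[ratr r, +oo[).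
  rewrite setTI; congr (measurable _); apply/seteqP.
  by split => x /=; rewrite in_itv/= andbT.
have rA k : exists CD : set (prod_borel T) * set (prod_borel T),
    [/\ measurable CD.1, measurable CD.2, coord_closed M CD.1,
      coord_closed M CD.2 & [/\ CD.1 `<=` A k, CD.2 `<=` ~` A k &
      (mu (~` (CD.1 `|` CD.2)) <= (e / (2 ^ k.+1)%:R)%:E)%E]].
  have [|C [D CDP]] := measurable_coord_regular M mu (mA k) (e := e / (2 ^ k.+1)%:R).
    by rewrite divr_gt0// ltr0n expn_gt0.
  by exists (C, D).
have [h hP] := choice rA.
have mh k : measurable ((h k).1 `|` (h k).2).
  by have [? ? _ _ _] := hP k; exact: measurableU.
exists (\bigcap_k ((h k).1 `|` (h k).2)); split.
- exact: bigcapT_measurable.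
- move=> G u l UG uK ul.
  have side k : (A k l /\ \forall m \near G, A k (u m)) \/
      (~ A k l /\ \forall m \near G, ~ A k (u m)).
    have [mC mD cC cD [CA DA _]] := hP k.
    have [GA|GA] := in_ultra_setVsetC [set m | A k (u m)] UG; [left|right].
      split => //; apply: CA; apply: (coord_closed_ultralimit _ cC _ ul).
      by apply: filterS GA => m Am; have [//|/DA] := uK m k I.
    split => //; apply: DA; apply: (coord_closed_ultralimit _ cD _ ul).
    by apply: filterS GA => m Am; have [/CA//|] := uK m k I.
  move=> r r0.
  have [q1] := rat_in_itvoo (ltr_pwDl r0 (lexx (f l - r))).
  rewrite in_itv/= => /andP[q1l q1r].
  have [q2] := rat_in_itvoo (ltr_pwDl r0 (lexx (f l))).
  rewrite in_itv/= => /andP[q2l q2r].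
  have [[]|[+ _]] := side (pickle q1); rewrite /A pickleK /=; last first.
    by move=> /negP; rewrite -ltNge; lra.
  move=> _ G1.
  have [[+ _]|[_ G2]] := side (pickle q2).
    by rewrite /A pickleK /=; lra.
  rewrite /A pickleK /= in G2.
  apply: filterS2 G1 G2 => m u1 /negP; rewrite -ltNge => u2.
  by rewrite ltr_norml; apply/andP; split; lra.
- apply: bigcap_small => //; first exact: ltW.
  by move=> k; have [_ _ _ _ []] := hP k.
Qed.

(* On a suitable set of almost full measure, coordinates at distance less than
   [delta] can be treated as equal in the Lipschitz bound: a violation for every
   [delta] would pass to an ultralimit, where it contradicts [f_lip]. *)
Lemma approx_lipschitz (c : 'I_n -> R) (K : set (prod_borel T)) (e : R) :
  (forall i, 0 <= c i) -> lipschitz_wrt c f -> net_bounded K ->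
  ultracontinuous K -> 0 < e ->
  exists2 delta : R, 0 < delta & forall x x', K x -> K x' ->
    f x - f x' <= \sum_i c i * (delta <= pdist (M i) (x i) (x' i))%R%:R + e.
Proof.
move=> c0 f_lip tbK ucK e0; apply: contrapT => nodelta.
have bad (m : nat) : exists xx : prod_borel T * prod_borel T, [/\ K xx.1, K xx.2 &
    \sum_i c i * (m.+1%:R^-1 <= pdist (M i) (xx.1 i) (xx.2 i))%R%:R + e <
    f xx.1 - f xx.2].
  apply: contrapT => nbad; apply: nodelta; exists (m.+1%:R^-1).
    by rewrite invr_gt0 ltr0n.
  move=> x x' Kx Kx'; rewrite leNgt; apply/negP => xx'.
  by apply: nbad; exists (x, x').
have [u uP] := choice bad.
have [G [UG ooG]] := @ultraFilterLemma nat \oo _.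
have limit (v : nat -> prod_borel T) : (forall m, K (v m)) -> exists l : prod_borel T,
    forall r i, 0 < r -> \forall m \near G, pdist (M i) (v m i) (l i) < r.
  move=> Kv.
  have /(_ _)/cid lim i : exists l, forall r, 0 < r ->
      \forall m \near G, pdist (M i) (v m i) l < r.
    apply: cauchy_ultralimit => r /tbK[N NP]; exists N.
    by apply: filterE => m; exact: NP.
  by exists (fun i => sval (lim i)) => r i r0; case: (lim i) => l /= /(_ _ r0).
have Ku1 m : K (u m).1 by have [] := uP m.
have Ku2 m : K (u m).2 by have [] := uP m.
have [l1 l1P] := limit _ Ku1; have [l2 l2P] := limit _ Ku2.
have e2 : 0 < e / 2 by rewrite divr_gt0.
have f1 := ucK _ _ _ UG Ku1 l1P _ e2; have f2 := ucK _ _ _ UG Ku2 l2P _ e2.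
(* If the limits differ in coordinate [i] by a distance [r], the sequences eventually stay at least
   r/3 apart there, while 1/(m+1) drops below r/3. *)
have far : \forall m \near G, forall i, l1 i != l2 i ->
    m.+1%:R^-1 <= pdist (M i) ((u m).1 i) ((u m).2 i).
  apply: filter_forall => i.
  have [ll|ll] := eqVneq (l1 i) (l2 i); first exact: filterE.
  have d0 : 0 < pdist (M i) (l1 i) (l2 i).
    rewrite lt_neqAle pdist_ge0 andbT eq_sym; apply/negP => /eqP/pdist_eq0.
    exact/eqP.
  set r := pdist _ _ _ in d0; have r3 : 0 < r / 3 by rewrite divr_gt0.
  have small : \forall m \near G, m.+1%:R^-1 < r / 3.
    apply: ooG; exists (Num.truncn ((r / 3)^-1)) => // m /= mr.
    rewrite invf_plt ?posrE ?ltr0n//; apply: lt_le_trans (truncnS_gt _) _.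
    by rewrite ler_nat.
  apply: filterS3 small (l1P _ i r3) (l2P _ i r3) => m /= mr m1 m2 _.
  have t1 := pdist_tri (M i) (l1 i) ((u m).1 i) (l2 i).
  have t2 := pdist_tri (M i) ((u m).1 i) ((u m).2 i) (l2 i).
  rewrite (pdistC (M i) (l1 i) ((u m).1 i)) -/r in t1.
  clearbody r; apply/ltW/(lt_le_trans mr); lra.
have [m [[m1 m2] mfar]] := filter_ex (filterI (filterI f1 f2) far).
have [_ _] := uP m; have := f_lip l1 l2.
move: m1 m2; rewrite /= !ltr_norml ler_norml.
move=> /andP[m11 m12] /andP[m21 m22] /andP[_ lip] viol.
have : \sum_i c i * (l1 i != l2 i)%:R <=
    \sum_i c i * (m.+1%:R^-1 <= pdist (M i) ((u m).1 i) ((u m).2 i))%R%:R.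
  apply: ler_sum => i _; rewrite ler_wpM2l// ler_nat.
  by case: (boolP (l1 i != l2 i)) => // /mfar ->.
lra.
Qed.

(** The full membership pattern in the first [N] balls: two points with equal patterns share a ball
    as soon as one of them is covered. *)
Definition cell N (e : R) i (t : T i) : {ffun 'I_N -> bool} :=
  [ffun k : 'I_N => pdist (M i) (pseq (M i) k) t < e].

Lemma cell_measurable N e i (v : {ffun 'I_N -> bool}) :
  measurable [set t : borel (T i) | cell N e t = v].
Proof.
have -> : [set t : borel (T i) | cell N e t = v] = \bigcap_(k in [set: 'I_N])
    [set t | (pdist (M i) (pseq (M i) k) t < e) = v k].
  apply/seteqP; split => [t /= <- k _ /=|t tv]; first by rewrite ffunE.
  by apply/ffunP => k; rewrite ffunE; exact: tv.
apply: fin_bigcap_measurable => [|k _]; first exact: finite_finset.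
have mb : measurable [set t : borel (T i) | pdist (M i) (pseq (M i) k) t < e].
  by apply: open_measurable_borel; exact: pdist_ball_open.
case: (v k); first exact: mb.
rewrite (_ : mkset _ = ~` [set t | pdist (M i) (pseq (M i) k) t < e]).
  exact: measurableC.
by apply/seteqP; split => t /=; [move=> ->|move/negP/negbTE].
Qed.

Lemma cell_close N e i (s t : T i) :
  (exists2 k, (k < N)%N & pdist (M i) (pseq (M i) k) s < e) ->
  cell N e s = cell N e t -> pdist (M i) s t < e + e.
Proof.
move=> [k kN sk] /ffunP/(_ (Ordinal kN)); rewrite !ffunE/= sk => /esym tk.
apply: le_lt_trans (pdist_tri (M i) s (pseq (M i) k) t) _.
by rewrite (pdistC (M i) s) ltrD.
Qed.

End LusinSets.

(** * Reduction to finitely many values *)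

Section FiniteValued.
Context (d : measure_display) (S : measurableType d) (R : realType).
Variable P : probability S R.

Lemma bounded_integrable (g : S -> R) (B : R) : measurable_fun setT g ->
  (forall w, `|g w| <= B) -> P.-integrable setT (EFin \o g).
Proof.
move=> mg gB; apply: measurable_bounded_integrable => //.
  by rewrite [X in (X < _)%E]probability_setT ltry.
exists B; split; first exact: num_real.
by move=> C BC w _; apply: le_trans (gB w) (ltW BC).
Qed.

Variables (Z : finType) (Y : S -> Z).
Hypothesis Y_meas : forall z, measurable (Y @^-1` [set z]).

Definition law z : R := fine (P (Y @^-1` [set z])).

Lemma law_ge0 z : 0 <= law z. Proof. exact: fine_ge0. Qed.

Lemma preimage_finite_measurable (A : set Z) : measurable (Y @^-1` A).
Proof.
have -> : Y @^-1` A = \bigcup_(z in A) Y @^-1` [set z].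
  by apply/seteqP; split=> w /=; [move=> Aw; exists (Y w)|move=> [z Az ->]].
by apply: fin_bigcup_measurable => //; exact: finite_finset.
Qed.

Lemma comp_finite_measurable (g : Z -> R) : measurable_fun setT (g \o Y).
Proof.
by move=> _ B mB; rewrite setTI; exact: (preimage_finite_measurable (g @^-1` B)).
Qed.

Lemma comp_finite_bounded (g : Z -> R) w : `|(g \o Y) w| <= \sum_z `|g z|.
Proof.
by rewrite [leRHS](bigD1 (Y w))//= lerDl; apply: sumr_ge0.
Qed.

Lemma integral_finite (g : Z -> R) :
  (\int[P]_w (g (Y w))%:E = (\sum_z law z * g z)%:E)%E.
Proof.
transitivity (\int[P]_w (\sum_z ((g z)%:E * (\1_(Y @^-1` [set z]) w)%:E)))%E.
  apply: eq_integral => w _; rewrite (bigD1 (Y w))//= big1 ?adde0.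
    by rewrite indicE mem_set// mule1.
  move=> z zY; rewrite indicE memNset ?mule0//= => Yw.
  by rewrite Yw eqxx in zY.
rewrite integral_sum//; last first.
  by move=> z; apply: integrableZl => //; exact: integrable_indic.
rewrite -sumEFin; apply: eq_bigr => z _.
rewrite integralZl//; last exact: integrable_indic.
rewrite integral_indic// setIT EFinM muleC fineK//.
exact: fin_num_measure.
Qed.

Lemma law_sum (E : pred Z) : P (Y @^-1` [set z | E z]) = (\sum_(z | E z) law z)%:E.
Proof.
have mE := preimage_finite_measurable [set z | E z].
rewrite -[Y @^-1` _]setIT -(integral_indic P measurableT mE).
transitivity (\int[P]_w ((fun z => (E z)%:R : R) (Y w))%:E)%E.
  apply: eq_integral => w _; rewrite indicE.
  by congr ((nat_of_bool _)%:R)%:E; apply/idP/idP; rewrite inE.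
rewrite (integral_finite (fun z => (E z)%:R)); congr EFin; rewrite [RHS]big_mkcond/=.
by apply: eq_bigr => z _; case: (E z); rewrite ?mulr1 ?mulr0.
Qed.

Lemma law_sum1 : \sum_z law z = 1.
Proof.
have := law_sum xpredT; rewrite (_ : [set z | _] = setT); last first.
  by rewrite -subTset.
by rewrite preimage_setT probability_setT => -[].
Qed.

End FiniteValued.

(** * Bags and the discretized vector *)

Section TreePartition.
Variables (W : finType) (G : sgraph W) (p : tree_partition G).

Definition bag_of (i : W) : tp_vertex p := sval (cid (tp_cover p i)).

Lemma mem_bag i u : (i \in tp_bag u) = (bag_of i == u).
Proof.
rewrite /bag_of; case: cid => v [/= iv v_uniq].
by apply/idP/eqP => [/v_uniq//|<-].
Qed.

Lemma bag_of_nonadjacent (U U' : {set tp_vertex p}) : [disjoint U & U']%B ->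
  (forall u v, u \in U -> v \in U' -> ~~ tp_forest p u v) ->
  forall i j, bag_of i \in U -> bag_of j \in U' -> ~~ G i j.
Proof.
move=> dUU' nadj i j iU jU'; apply/negP => ij.
have uv : bag_of i != bag_of j.
  by apply: contraTneq jU' => <-; rewrite (disjointFr dUU').
have /negP := nadj _ _ iU jU'; apply; apply/(tp_adj uv).
by exists i, j; rewrite !mem_bag !eqxx.
Qed.

End TreePartition.

Section DiscretizedVector.
Context (d : measure_display) (S : measurableType d) (R : realType).
Variables (P : probability S R) (n : nat) (T : 'I_n -> ptopologicalType).
Variables (X : {RV P >-> prod_borel T}) (G : sgraph 'I_n).
Hypothesis X_dep : graph_dependent P X G.
Variables (K : finType) (q : forall i, T i -> K).
Hypothesis q_meas : forall i v, measurable [set t : borel (T i) | q t = v].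

Definition discretize (x : prod_borel T) : {ffun 'I_n -> K} :=
  [ffun i => q (x i)].

(** The event is a finite union, over the patterns [z] in [E], of constraints on the coordinates in
    [I] alone; the other coordinates may be dropped because [E] ignores them. *)
Lemma sigma_family_discretize (I : {set 'I_n}) (E : pred {ffun 'I_n -> K}) :
  (forall z z' : {ffun 'I_n -> K}, (forall i, i \in I -> z i = z' i) -> E z = E z') ->
  sigma_family X I [set w | E (discretize (X w))].
Proof.
move=> dE.
have -> : [set w | E (discretize (X w))] = \bigcup_(z in [set z | E z])
    \bigcap_(i in [set: 'I_n])
      (if i \in I then [set w | q (X w i) = z i] else setT).
  apply/seteqP; split => [w /= Ew|w [z /= Ez wz]].
    exists (discretize (X w)) => // i _; case: ifP => //= _; by rewrite ffunE.
  rewrite -(dE z)// => i iI; have := wz i Logic.I; rewrite iI/= => <-.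
  by rewrite ffunE.
pose Sg := g_sigma_algebraType (\bigcup_(i in [set` I])
  preimage_set_system setT (fun w => X w i : borel (T i)) measurable).
suff : measurable (\bigcup_(z in [set z | E z]) \bigcap_(i in [set: 'I_n])
    (if i \in I then [set w | q (X w i) = z i] else setT) : set Sg) by [].
apply: fin_bigcup_measurable => [|z _]; first exact: finite_finset.
apply: fin_bigcap_measurable => [|i _]; first exact: finite_finset.
case: ifP => // iI; apply: sub_sigma_algebra; exists i => //.
exists [set t | q t = z i]; first exact: q_meas.
by rewrite setTI.
Qed.

Lemma discretize_measurable z : measurable ((discretize \o X) @^-1` [set z]).
Proof.
have -> : (discretize \o X) @^-1` [set z] =
    X @^-1` \bigcap_(i in [set: 'I_n]) cylinder [set t : borel (T i) | q t = z i].
  apply/seteqP; split => [w /= <- i _ /=|w /= wz]; first by rewrite ffunE.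
  by apply/ffunP => i; rewrite ffunE; exact: (wz i Logic.I).
rewrite -[X in measurable X]setTI; apply: measurable_funPT => //.
apply: fin_bigcap_measurable => [|i _]; first exact: finite_finset.
exact: cylinder_measurable.
Qed.

(** Bags not adjacent in the forest contain index sets not adjacent in [G], to which the graph
    dependence applies. *)
Lemma discretize_block_indep (p : tree_partition G) (U U' : {set tp_vertex p}) :
  [disjoint U & U']%B ->
  (forall u v, u \in U -> v \in U' -> ~~ tp_forest p u v) ->
  block_indep (bag_of p) (law P (discretize \o X)) U U'.
Proof.
move=> dUU' nadj E E' dE dE'.
pose J (A : {set tp_vertex p}) := [set i | bag_of p i \in A]%SET.
have sig A (E0 : pred {ffun 'I_n -> K}) : determined (bag_of p) A E0 ->
    sigma_family X (J A) [set w | E0 (discretize (X w))].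
  move=> dE0; apply: (@sigma_family_discretize (J A) E0) => z z' zz'; apply: dE0.
  by apply/agreeP => i iA; apply: zz'; rewrite inE.
have := X_dep (I := J U) (J := J U') _ _ (sig _ _ dE) (sig _ _ dE').
move=> indep; apply: EFin_inj; rewrite EFinM -!(law_sum _ discretize_measurable).
have -> : (discretize \o X) @^-1` [set z | E z && E' z] =
    [set w | E (discretize (X w))] `&` [set w | E' (discretize (X w))].
  by apply/seteqP; split => w /= => [/andP[]|[-> ->]].
apply: indep.
  rewrite finset.disjoints_subset; apply/fintype.subsetP => i; rewrite !inE => iU.
  by rewrite (disjointFr dUU').
by move=> i j; rewrite !inE; exact: bag_of_nonadjacent.
Qed.

End DiscretizedVector.

(* The McShane extension, from the cells meeting [A] to all cells. *)
Lemma lipschitz_discretization (R : realType) (n : nat)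
    (T : 'I_n -> ptopologicalType) (K : finType) (q : forall i, T i -> K)
    (c : 'I_n -> R) (f : prod_borel T -> R) (A : set (prod_borel T)) (e : R) :
  (forall i, 0 <= c i) -> lipschitz_wrt c f -> A !=set0 ->
  (forall x x', A x -> A x' ->
    f x - f x' <= \sum_i c i * (q i (x i) != q i (x' i))%:R + e) ->
  exists g : {ffun 'I_n -> K} -> R,
    [/\ forall z z', g z - g z' <= \sum_i c i * (z i != z' i)%:R,
        forall x, A x -> `|g (discretize q x) - f x| <= e &
        forall x, g (discretize q x) - f x <= 2 * \sum_i c i].
Proof.
move=> c0 f_lip [x0 Ax0] fA.
pose D (z z' : {ffun 'I_n -> K}) := \sum_i c i * (z i != z' i)%:R.
have D_tri x y z : D x z <= D x y + D y z.
  rewrite /D -big_split/=; apply: ler_sum => i _; rewrite -mulrDr ler_wpM2l//.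
  rewrite -natrD ler_nat; have [//|xz] := eqVneq (x i) (z i).
  by have [<-|//] := eqVneq (x i) (y i); rewrite xz.
have D_le z z' : D z z' <= \sum_i c i.
  by apply: ler_sum => i _; rewrite ler_piMr// lern1 leq_b1.
have Dzz z : D z z = 0 by rewrite /D big1// => i _; rewrite eqxx mulr0.
pose dq := discretize q.
have /choice[rep repP] (z : {ffun 'I_n -> K}) : exists x, A x /\
    ((exists2 y, A y & dq y = z) -> dq x = z).
  have [[y Ay yz]|nz] := pselect (exists2 y, A y & dq y = z).
    by exists y; split.
  by exists x0; split => // /nz.
have Arep z : A (rep z) by have [] := repP z.
have dq_rep x : A x -> dq (rep (dq x)) = dq x.
  by move=> Ax; have [_] := repP (dq x); apply; exists x.
(* When the cell of [z'] misses [A], [rep z'] is [x0], and the distance is measured to the true cell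
   of [x0]; the minimum can therefore run over all [z']. *)
pose h z' z := f (rep z') + D z (dq (rep z')).
pose best z := [arg min_(z' < z) h z' z]%O.
pose g z := h (best z) z.
have g_le z z' : g z <= h z' z by rewrite /g /best; case: arg_minP => // u _; exact.
have DE x y : D (dq x) (dq y) = \sum_i c i * (q i (x i) != q i (y i))%:R.
  by apply: eq_bigr => i _; rewrite !ffunE.
exists g; split.
- move=> z z'; rewrite lerBlDr; apply: le_trans (g_le z (best z')) _.
  by have := D_tri z z' (dq (rep (best z'))); rewrite /g /h -/(D z z'); lra.
- move=> x Ax; rewrite ler_norml; apply/andP; split.
    have := fA _ _ Ax (Arep (best (dq x))); rewrite -DE /g /h -/dq; lra.
  have := g_le (dq x) (dq x); rewrite /h dq_rep// Dzz.
  have := fA _ _ (Arep (dq x)) Ax; rewrite -DE dq_rep// Dzz; rewrite -/dq; lra.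
- move=> x; have := g_le (dq x) (dq x); rewrite /h -/dq.
  have := D_le (dq x) (dq (rep (dq x))).
  have := f_lip (rep (dq x)) x; rewrite ler_norml => /andP[_].
  have : \sum_i c i * (rep (dq x) i != x i)%:R <= \sum_i c i.
    by apply: ler_sum => i _; rewrite ler_piMr// lern1 leq_b1.
  lra.
Qed.

Lemma ctilde_block_sum (R : realType) (W : finType) (G : sgraph W)
    (p : tree_partition G) (c : W -> R) (U : {set tp_vertex p}) :
  \sum_(i | bag_of p i \in U) c i = \sum_(u in U) ctilde c u.
Proof.
rewrite (partition_big (bag_of p) (mem U))//=; apply: eq_bigr => u uU.
apply: eq_bigl => i; rewrite mem_bag; apply/andP/idP => [[]//|/eqP iu].
by rewrite iu uU eqxx.
Qed.

(** * Tail bound for a given tree-partition *)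

Section Tail.
Context (R : realType) (n : nat) (n_gt0 : (0 < n)%N) (T : 'I_n -> ptopologicalType).
Hypothesis polishT : forall i, polish R (T i).
Variable c : 'I_n -> R.
Hypothesis c_ge0 : forall i, 0 <= c i.
Variable f : prod_borel T -> R.
Hypotheses (f_meas : measurable_fun setT f) (f_lip : lipschitz_wrt c f).
Context (d : measure_display) (S : measurableType d).
Variables (P : probability S R) (X : {RV P >-> prod_borel T}).
Variables (G : sgraph 'I_n) (p : tree_partition G).
Hypothesis X_dep : graph_dependent P X G.

Let C := \sum_i c i.

Let C_ge0 : 0 <= C. Proof. exact: sumr_ge0. Qed.

Let Xmeas : measurable_fun setT X. Proof. exact: measurable_funPT. Qed.

Lemma lipschitz_RV_measurable : measurable_fun setT (f \o X).
Proof. exact: measurableT_comp. Qed.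

Lemma lipschitz_RV_integrable : P.-integrable setT (EFin \o (f \o X)).
Proof.
pose x0 : prod_borel T := fun i => point.
apply: (@bounded_integrable _ _ _ P _ (C + `|f x0|)).
  exact: lipschitz_RV_measurable.
move=> w /=; rewrite -[f (X w)](subrK (f x0)).
apply: le_trans (ler_normD _ _) _; rewrite lerD2r.
apply: le_trans (f_lip _ _) _; apply: ler_sum => i _.
by rewrite ler_piMr// lern1 leq_b1.
Qed.

Let m := fine 'E_P[f \o X]%E.

Lemma lipschitz_RV_expectation : ('E_P[f \o X] = m%:E)%E.
Proof.
rewrite /m fineK// unlock integrable_fin_num//.
exact: lipschitz_RV_integrable.
Qed.

Lemma block_lipschitz (K : finType) (g : {ffun 'I_n -> K} -> R) :
  (forall z z', g z - g z' <= \sum_i c i * (z i != z' i)%:R) ->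
  forall (U : {set tp_vertex p}) z z', agree (bag_of p) (~: U) z z' ->
  g z - g z' <= \sum_(u in U) ctilde c u.
Proof.
move=> g_lip U z z' zz'; apply: le_trans (g_lip _ _) _.
rewrite -ctilde_block_sum [leRHS]big_mkcond/=; apply: ler_sum => i _.
case: ifPn => iU; first by rewrite ler_piMr// lern1 leq_b1.
by rewrite (agreeP _ _ _ _ zz') ?inE// eqxx mulr0.
Qed.

(** The summand [e] bounds the mass outside [A]. The shift [(2 + 2 * C) * e] collects [e] for the
    gap between [f] and [g] on [A], and [e + 2 * C * e] for the gap between their means. *)
Lemma approx_tail (s t e : R) : 0 <= s -> 0 < e < 1 ->
  (P [set w | (t + m <= f (X w))%R] <=
   (e + expR (- (s * (t - (2 + 2 * C) * e)) +
              s ^+ 2 * tp_weight c p / 8))%:E)%E.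
Proof.
move=> s0 /andP[e0 e1].
have /(_ _)/cid M' i : exists _ : polish_metric R (T i), True.
  by have [M] := polish_metric_exists (polishT i); exists M.
pose M i := sval (M' i).
pose mu : probability (prod_borel T) R := distribution P X.
have muT : mu setT = 1%E by exact: probability_setT.
have e2 : 0 < e / 2 by rewrite divr_gt0.
have [K1 [mK1 tbK1 muK1]] := net_bounded_exists M mu e2.
have [K2 [mK2 ucK2 muK2]] := ultracontinuous_exists M mu f_meas e2.
pose A := K1 `&` K2.
have mA : measurable A by exact: measurableI.
have muA : (mu (~` A) <= e%:E)%E by rewrite [e]splitr; exact: setI_small.
have A0 : A !=set0.
  apply/set0P/eqP => A0; move: muA; rewrite A0 setC0.
  by rewrite muT lee_fin leNgt e1.
have tbA : net_bounded M A by move=> r /tbK1[N h]; exists N => x [/h].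
have ucA : ultracontinuous M f A.
  by move=> Gf u l UG uA; apply: ucK2 => k; have [] := uA k.
have [delta delta0 deltaP] := approx_lipschitz c_ge0 f_lip tbA ucA e0.
have [N NP] := tbA _ (divr_gt0 delta0 (ltr0n R 2)).
(* With balls of radius [delta / 2], points of [A] in the same cell are at distance less than
   [delta]. *)
pose q i := @cell _ _ _ M N (delta / 2) i.
have q_meas i v : measurable [set t : borel (T i) | q i t = v].
  exact: cell_measurable.
have [g [g_lip g_near g_le]] : exists g : {ffun 'I_n -> {ffun 'I_N -> bool}} -> R,
    [/\ forall z z', g z - g z' <= \sum_i c i * (z i != z' i)%:R,
        forall x, A x -> `|g (discretize q x) - f x| <= e &
        forall x, g (discretize q x) - f x <= 2 * C].
  apply: lipschitz_discretization => // x x' Ax Ax'.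
  apply: le_trans (deltaP x x' Ax Ax') _; rewrite lerD2r.
  apply: ler_sum => i _; rewrite ler_wpM2l// ler_nat.
  case: (leP delta) => // far; rewrite lt0b; apply/eqP => qxx'.
  have := cell_close (NP x Ax i) qxx'.
  by rewrite -splitr ltNge far.
pose Y := discretize q \o X.
have Y_meas z : measurable (Y @^-1` [set z]) by exact: discretize_measurable.
pose lw := law P Y.
have PA : (P (X @^-1` (~` A)) <= e%:E)%E by [].
have mXA : measurable (X @^-1` (~` A)).
  by rewrite -[X in measurable X]setTI; apply: Xmeas => //; exact: measurableC.
(* On [A] the functions differ by at most [e]; outside, the crude bound [2 * C] is weighted by a
   mass of at most [e]. *)
have mean_le : \sum_z lw z * g z <= m + e + 2 * C * e.
  rewrite -lee_fin -(integral_finite P Y_meas).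
  apply: (@le_trans _ _ (\int[P]_w ((f (X w) + e)%:E +
      (2 * C)%:E * (\1_(X @^-1` (~` A)) w)%:E))%E).
    apply: le_integral => //.
    - apply: (@bounded_integrable _ _ _ P (g \o Y) (\sum_z `|g z|)).
        exact: comp_finite_measurable.
      exact: comp_finite_bounded.
    - apply: integrableD => //; last first.
        by apply: integrableZl => //; exact: integrable_indic.
      apply: (eq_integrable _ (fun w => (EFin \o (f \o X)) w + (cst e w)%:E)%E) => //.
      apply: integrableD => //; first exact: lipschitz_RV_integrable.
      apply: (@bounded_integrable _ _ _ P (cst e) `|e|) => //.
    - move=> w _; rewrite -EFinM -EFinD lee_fin indicE.
      have [Aw|nAw] := pselect (A (X w)).
        have := g_near _ Aw; rewrite ler_norml => /andP[_].
        rewrite memNset/=; last by move=> /(_ Aw).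
        by rewrite mulr0 addr0; rewrite /Y/=; lra.
      rewrite mem_set//= mulr1.
      by have := g_le (X w); rewrite /Y/=; lra.
  rewrite integralD//; last 2 first.
  - apply: (eq_integrable _ (fun w => (EFin \o (f \o X)) w + (cst e w)%:E)%E) => //.
    apply: integrableD => //; first exact: lipschitz_RV_integrable.
    apply: (@bounded_integrable _ _ _ P (cst e) `|e|) => //.
  - by apply: integrableZl => //; exact: integrable_indic.
  rewrite integralZl//; last exact: integrable_indic.
  rewrite integral_indic// setIT.
  under eq_integral do rewrite EFinD.
  rewrite integralD//; last 2 first.
  - exact: lipschitz_RV_integrable.
  - by apply: (@bounded_integrable _ _ _ P (cst e) `|e|).
  rewrite (_ : \int[P]_x (f (X x))%:E = m%:E)%E; last first.
    by rewrite -lipschitz_RV_expectation unlock.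
  rewrite integral_cst// [X in (_ * X)%E]probability_setT mule1 2!EFinD.
  by rewrite leeD2l// [X in (_ <= X)%E]EFinM lee_wpmul2l// lee_fin mulr_ge0.
have law_tail : (P (Y @^-1` [set z | ((t - (2 + 2 * C) * e) +
    \sum_y lw y * g y <= g z)%R]) <= (expR (- (s * (t - (2 + 2 * C) * e)) +
    s ^+ 2 * tp_weight c p / 8))%:E)%E.
  rewrite law_sum// lee_fin.
  (* The root is a lightest vertex of its tree. Sets that are not trees get a default vertex, which
     exists because [n] is positive. *)
  have rt_ex (B : {set tp_vertex p}) : exists u, B \in trees (tp_forest p) ->
      u \in B /\ ctilde_min c B = ctilde c u.
    have [Bt|Bt] := boolP (B \in trees (tp_forest p)).
      by have [u uB [uE _]] := ctilde_min_attained c Bt; exists u.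
    by exists (bag_of p (Ordinal n_gt0)).
  have [rt rtP] := choice rt_ex.
  have weightE : tp_weight c p = \sum_(B in trees (tp_forest p)) ctilde c (rt B) ^+ 2 +
      \sum_(D in edges (tp_forest p)) (\sum_(v in D) ctilde c v) ^+ 2.
    by congr (_ + _); apply: eq_bigr => B /rtP[_ ->].
  rewrite weightE; apply: (@forest_tail _ (tp_forest p) _ R _ _ (bag_of p)) => //.
  - exact: tp_forestP.
  - exact: law_ge0.
  - exact: law_sum1.
  - by move=> U U' dUU' nadj; exact: discretize_block_indep.
  - by move=> B /rtP[].
  - exact: block_lipschitz.
  - by move=> v; exact: sumr_ge0.
rewrite EFinD; apply: le_trans (leeD PA law_tail).
have mtail := preimage_finite_measurable Y_meas [set z | ((t - (2 + 2 * C) * e) +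
    \sum_y lw y * g y <= g z)%R].
apply: le_trans; last first.
  by apply: measureU2; [exact: mXA|exact: mtail].
apply: le_measure; rewrite ?inE; [|exact: measurableU|].
  rewrite (_ : mkset _ = (f \o X) @^-1` `[t + m, +oo[); last first.
    by apply/seteqP; split => w /=; rewrite in_itv/= andbT.
  by rewrite -[X in measurable X]setTI; apply: lipschitz_RV_measurable.
move=> w /= tf; have [Aw|nAw] := pselect (A (X w)); [right|by left].
have := g_near _ Aw; rewrite ler_norml => /andP[+ _].
rewrite /Y/=; lra.
Qed.

(** Let [e] tend to 0 from the right in [approx_tail], whose bound is continuous in [e]. *)
Lemma weight_tail (s t : R) : 0 <= s ->
  (P [set w | (t + m <= f (X w))%R] <=
   (expR (- (s * t) + s ^+ 2 * tp_weight c p / 8))%:E)%E.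
Proof.
move=> s0; set A := [set w | _].
have mA : measurable A.
  rewrite (_ : A = (f \o X) @^-1` `[t + m, +oo[); last first.
    by apply/seteqP; split => w /=; rewrite in_itv/= andbT.
  by rewrite -[X in measurable X]setTI; apply: lipschitz_RV_measurable.
have PA : P A = (fine (P A))%:E by rewrite fineK//; exact: fin_num_measure.
pose k := s * (2 + 2 * C).
pose a := - (s * t) + s ^+ 2 * tp_weight c p / 8.
have bound e : 0 < e < 1 -> fine (P A) <= e + expR (a + k * e).
  move=> e01; rewrite -lee_fin -PA; apply: le_trans (approx_tail t s0 e01) _.
  rewrite lee_fin lerD2l ler_expR /a /k le_eqVlt; apply/orP; left; apply/eqP.
  by ring.
rewrite PA lee_fin -/a.
have cvg : (fun e : R => e + expR (a + k * e)) x @[x --> 0^'+] --> 0 + expR (a + k * 0).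
  apply: cvg_within_filter.
  apply: cvgD; first exact: cvg_id.
  apply: continuous_cvg; first exact: continuous_expR.
  by apply: cvgD; [exact: cvg_cst|apply: cvgM; [exact: cvg_cst|exact: cvg_id]].
rewrite mulr0 add0r addr0 in cvg.
apply: (cvgr_to_ge cvg).
near=> e; apply: bound; apply/andP; split; near: e.
  exact: nbhs_right_gt.
exact: nbhs_right_lt.
Unshelve. all: by end_near. Qed.

End Tail.

Theorem theorem2p12 (R : realType) (n : nat) (n_ge1 : (1 <= n)%N)
    (T : 'I_n -> ptopologicalType) (polishT : forall i, polish R (T i))
    (c : 'I_n -> R) (c_ge0 : forall i, 0 <= c i)
    (f : prod_borel T -> R) (f_meas : measurable_fun setT f)
    (f_lip : lipschitz_wrt c f)
    (d : measure_display) (S : measurableType d) (P : probability S R)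
    (X : {RV P >-> prod_borel T})
    (G : sgraph 'I_n) (X_dep : graph_dependent P X G)
    (t : R) (t_gt0 : 0 < t) :
  (P [set w | t%:E <= (f (X w))%:E - 'E_P[f \o X]] <=
   expeR (- ((2 * t ^+ 2)%:E / (Dweight G c)%:E)))%E.
Proof.
have [p -> _] := Dweight_attained G c.
have tail := weight_tail n_ge1 polishT c_ge0 f_meas f_lip p X_dep.
have mean := lipschitz_RV_expectation c_ge0 f_meas f_lip X.
set m := fine _ in tail mean.
rewrite mean.
have -> : [set w | (t%:E <= (f (X w))%:E - m%:E)%E] = [set w | t + m <= f (X w)].
  by apply/seteqP; split => w /=; rewrite -EFinB lee_fin lerBrDr.
set D := tp_weight c p in tail *.
have D_ge0 : 0 <= D by apply: addr_ge0; apply: sumr_ge0 => *; exact: sqr_ge0.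
rewrite /inve; have [D0|D_neq0] := eqVneq D 0; last first.
  have D_gt0 : 0 < D by rewrite lt_neqAle eq_sym D_neq0.
  (* This [s] minimizes [- (s * t) + s ^+ 2 * D / 8]. *)
  apply: le_trans (tail (4 * t / D) t _) _.
    by rewrite divr_ge0// mulr_ge0// ltW.
  rewrite -EFinM -EFinN/= lee_fin ler_expR le_eqVlt; apply/orP; left; apply/eqP.
  by field.
(* For weight 0 the quotient is +oo and the bound is 0, so the probability has to vanish. *)
rewrite gt0_muley ?lte_fin ?mulr_gt0 ?exprn_gt0//=.
rewrite leNgt; apply/negP => Ppos.
set A := [set w | _] in tail Ppos.
have Afin : (P A < +oo)%E.
  by apply: le_lt_trans (tail 0 t (lexx 0)) _; rewrite ltry.
set x := fine (P A).
have x_gt0 : 0 < x by rewrite fine_gt0// Ppos.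
(* Here [s * t = 1 / x], so the bound reads x <= exp(-1/x), which contradicts exp(1/x) >= 1 +
   1/x. *)
have := tail (x^-1 / t) t (divr_ge0 (ltW _) (ltW t_gt0)).
rewrite invr_gt0 => /(_ x_gt0).
rewrite D0 mulr0 mul0r addr0 divfK ?gt_eqF//.
rewrite -[P A]fineK ?ge0_fin_numE// lee_fin -/x leNgt => /negP; apply.
rewrite expRN invf_plt ?posrE ?expR_gt0//.
by apply: lt_le_trans (expR_ge1Dx _); rewrite ltrDr.
Qed.
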